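(* Let $\varsigma\in M^1(\mathbb{Z}^n\times\mathbb{T}^n)$ and $g_1,g_2\in M^1(\mathbb{Z}^n)$. Then, for fixed $2\le p<\infty$, the localization operator $\mathfrak{L}^{g_1,g_2}_\varsigma:M^p(\mathbb{Z}^n)\to M^p(\mathbb{Z}^n)$ is compact.
   Context: $\mathbb{T}^n$ is the torus with normalized Haar measure $dw$; $\mathbb{Z}^n\times\mathbb{T}^n$ carries the product of counting measure and $dw$. $T_mf(k)=f(k-m)$, $M_wf(k)=e^{2\pi i w\cdot k}f(k)$, and the short-time Fourier transform is $V_gf(m,w)=\langle f,M_wT_mg\rangle=\sum_{k\in\mathbb{Z}^n}f(k)\overline{g(k-m)}e^{-2\pi i w\cdot k}$. $\mathcal{S}(\mathbb{Z}^n)$ is the space of rapidly decreasing functions on $\mathbb{Z}^n$, $\mathcal{S}'(\mathbb{Z}^n)$ its dual (tempered distributions); $\mathcal{S}(\mathbb{Z}^n\times\mathbb{T}^n)$ and $\mathcal{S}'(\mathbb{Z}^n\times\mathbb{T}^n)$ are the Schwartz functions and tempered distributions on the group $\mathbb{Z}^n\times\mathbb{T}^n$. Modulation spaces: fix a non-zero window $g\in\mathcal{S}(\mathbb{Z}^n)$; for $1\le p\le\infty$, $M^p(\mathbb{Z}^n)=\{f\in\mathcal{S}'(\mathbb{Z}^n): V_gf\in L^p(\mathbb{Z}^n\times\mathbb{T}^n)\}$ with $\|f\|_{M^p(\mathbb{Z}^n)}=\|V_gf\|_{L^p}$. Similarly, fix a non-zero $g\in\mathcal{S}(\mathbb{Z}^n\times\mathbb{T}^n)$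 and set $$V_gF(m,\omega,\xi,k)=\sum_{j\in\mathbb{Z}^n}\int_{\mathbb{T}^n}e^{-2\pi i j\xi}e^{-2\pi i\eta k}F(j,\eta)\overline{g(j-m,\eta-\omega)}\,d\eta,\quad m,k\in\mathbb{Z}^n,\ \omega,\xi\in\mathbb{T}^n;$$ $M^p(\mathbb{Z}^n\times\mathbb{T}^n)$ is the space of $F\in\mathcal{S}'(\mathbb{Z}^n\times\mathbb{T}^n)$ with $\|F\|_{M^p(\mathbb{Z}^n\times\mathbb{T}^n)}=\|V_gF\|_{L^p((\mathbb{Z}^n\times\mathbb{T}^n)\times(\mathbb{T}^n\times\mathbb{Z}^n))}<\infty$. Different windows give equivalent norms. Localization operator: $$\mathfrak{L}^{g_1,g_2}_\varsigma f(k)=\sum_{m\in\mathbb{Z}^n}\int_{\mathbb{T}^n}\varsigma(m,w)V_{g_1}f(m,w)\,M_wT_mg_2(k)\,dw,\qquad k\in\mathbb{Z}^n.$$ *)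

(* Defs.v *)
From HB Require Import structures.
From mathcomp Require Import all_boot all_order all_algebra.
From mathcomp Require Import all_classical all_reals all_analysis.
From mathcomp Require Import complex.

Set Implicit Arguments.
Unset Strict Implicit.
Unset Printing Implicit Defensive.
Import Order.TTheory GRing.Theory Num.Theory.
Import numFieldNormedType.Exports.
Import Normc.

Local Open Scope classical_set_scope.
Local Open Scope ring_scope.
Local Open Scope complex_scope.

(* The alias keeps the pointed and discrete measurable structures of Z^n away
   from the generic matrix instances. *)

Definition Zn (n : nat) : Type := 'rV[int]_n.

HB.instance Definition _ n := GRing.Zmodule.on (Zn n).
HB.instance Definition _ n := Countable.on (Zn n).
HB.instance Definition _ n := isPointed.Build (Zn n) 0.
HB.instance Definition _ n := @isMeasurable.Build default_measure_display
  (Zn n) discrete_measurable discrete_measurable0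
  discrete_measurableC discrete_measurableU.

Lemma sigma_finite_countZ (R : realType) n :
  sigma_finite [set: Zn n] (@counting (Zn n) R).
Proof.
exists (fun i => [set k : Zn n | pickle k = i]).
  by apply/seteqP; split => // k _; exists (pickle k).
move=> i; split => //.
rewrite /counting asboolT ?ltry//.
apply: (@sub_finite_set _ _ (odflt 0 @` [set (pickle_inv i : option (Zn n))])).
  by move=> k /= <-; exists (Some k) => //=; rewrite pickleK_inv.
exact/finite_image/finite_set1.
Qed.

HB.instance Definition _ (R : realType) (n : nat) :=
  @Measure_isSigmaFinite.Build _ _ _ (@counting (Zn n) R) (sigma_finite_countZ R n).

(* T^n = R^n / Z^n: points are represented in R^n = 'rV[R]_n with its Borel
   (= product) sigma-algebra, functions on T^n are Z^n-periodic functions on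
   R^n, and the normalized Haar measure is carried by the unit cube, as the
   n-fold product of the uniform probability on [0, 1] (see [haar]). *)

Section rV_measurable.
Variables (R : realType) (n : nat).

Let coor (i : 'I_n) (x : 'rV[R]_n) : R := x 0 i.

Let rV_set0 : g_sigma_preimage coor set0.
Proof. exact: sigma_algebra0. Qed.

Let rV_setC A : g_sigma_preimage coor A -> g_sigma_preimage coor (~` A).
Proof. exact: sigma_algebraC. Qed.

Let rV_bigcup (F : _^nat) : (forall i, g_sigma_preimage coor (F i)) ->
  g_sigma_preimage coor (\bigcup_i (F i)).
Proof. exact: sigma_algebra_bigcup. Qed.

HB.instance Definition _ := @isMeasurable.Build default_measure_display
  'rV[R]_n (g_sigma_preimage coor) rV_set0 rV_setC rV_bigcup.

Lemma measurable_coor (i : 'I_n) :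
  measurable_fun [set: 'rV[R]_n] (fun x : 'rV[R]_n => x 0 i).
Proof.
move=> _ Y mY; rewrite setTI; apply: sub_sigma_algebra => /=.
rewrite -bigcup_seq/=; exists i => /=; first by rewrite mem_index_enum.
by exists Y => //; rewrite setTI.
Qed.

Lemma measurable_fun_rV d (T : measurableType d) (f : T -> 'rV[R]_n) :
  (forall i, measurable_fun setT (fun t => f t 0 i)) -> measurable_fun setT f.
Proof.
move=> mf; suff H : g_sigma_preimage coor `<=`
    [set A | measurable (f @^-1` A)].
  by move=> _ A mA; rewrite setTI; exact: H.
apply: smallest_sub.
  split => /=.
  - by rewrite preimage_set0.
  - by move=> A mA; rewrite setTD preimage_setC; exact: measurableC.
  - by move=> F mF; rewrite preimage_bigcup; exact: bigcup_measurable.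
rewrite -bigcup_seq => A [i _ [B mB <-]] /=.
by rewrite setTI -comp_preimage -[X in measurable X]setTI; exact: mf.
Qed.

End rV_measurable.

Section haar_step.
Variables (R : realType) (n : nat).

Definition cons_rV (x : measurableTypeR R * 'rV[R]_n) : 'rV[R]_n.+1 :=
  row_mx (x.1)%:M x.2 : 'rV[R]_(1 + n).

Lemma measurable_cons_rV : measurable_fun setT cons_rV.
Proof.
apply: measurable_fun_rV => i; rewrite /cons_rV.
have [j ->|j ->] := @split_ordP 1 n i.
- rewrite [X in measurable_fun _ X](_ : _ = fst); first exact: measurable_fst.
  by apply/funext => t; rewrite (@row_mxEl _ 1 1 n) mxE ord1 eqxx mulr1n.
- rewrite [X in measurable_fun _ X](_ : _ =
      (fun x : 'rV[R]_n => x 0 j) \o snd).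
    exact: measurableT_comp (@measurable_coor R n j) measurable_snd.
  by apply/funext => t /=; rewrite (@row_mxEr _ 1 1 n).
Qed.

HB.instance Definition _ :=
  isMeasurableFun.Build _ _ _ _ cons_rV measurable_cons_rV.

End haar_step.

Fixpoint haar (R : realType) (n : nat) : probability 'rV[R]_n R :=
  match n with
  | 0 => \d_ (0 : 'rV[R]_0)
  | n'.+1 => distribution (uniform_prob (@ltr01 R) \x haar R n')%E
                          (@cons_rV R n')
  end.

Definition haarZT (R : realType) (n : nat) :
    {measure set (Zn n * 'rV[R]_n) -> \bar R} :=
  (@counting (Zn n) R \x haar R n)%E.

(* A definition with its own sigma-finite instance: the canonical one for
   [\x] only applies to (sub)probabilities. *)
Definition haarTZ (R : realType) (n : nat) : set ('rV[R]_n * Zn n) -> \bar R :=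
  (haar R n \x @counting (Zn n) R)%E.
Arguments haarTZ : clear implicits.

HB.instance Definition _ (R : realType) (n : nat) :=
  Measure.copy (haarTZ R n) (haar R n \x @counting (Zn n) R)%E.

Lemma sigma_finite_haarTZ (R : realType) n : sigma_finite setT (haarTZ R n).
Proof.
have [F FT Foo] := sigma_finite_countZ R n.
exists (fun i => setT `*` F i).
  apply/seteqP; split => // -[x k] _.
  by have [i _ Fik] : (\bigcup_i F i) k by [rewrite -FT]; exists i.
move=> i; have [mF Fi] := Foo i; split; first exact: measurableX.
rewrite /haarTZ product_measure1E//; apply: lte_mul_pinfty => //=.
exact: fin_num_measure.
Qed.

HB.instance Definition _ (R : realType) (n : nat) :=
  Measure_isSigmaFinite.Build _ _ _ (haarTZ R n) (sigma_finite_haarTZ R n).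

Definition haarZTTZ (R : realType) (n : nat) :
    {measure set ((Zn n * 'rV[R]_n) * ('rV[R]_n * Zn n)) -> \bar R} :=
  (haarZT R n \x haarTZ R n)%E.

Section complex_integral.
Context d (T : measurableType d) (R : realType).
Variable mu : {measure set T -> \bar R}.
Implicit Type f : T -> R[i].

Definition cmeasurable f : Prop :=
  measurable_fun setT (fun x => complex.Re (f x)) /\
  measurable_fun setT (fun x => complex.Im (f x)).

Definition cintegrable f : Prop :=
  mu.-integrable setT (fun x => (complex.Re (f x))%:E) /\
  mu.-integrable setT (fun x => (complex.Im (f x))%:E).

(* meaningful when [cintegrable f] *)
Definition cintegral f : R[i] :=
  (\int[mu]_x complex.Re (f x)) +i* (\int[mu]_x complex.Im (f x)).

Definition cLnorm (p : R) f : \bar R :=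
  Lnorm mu p%:E (fun x => (normc (f x))%:E).

Definition inLp (p : R) f : Prop := cmeasurable f /\ (cLnorm p f < +oo)%E.

End complex_integral.

(* Sums over Z^n are integrals for the counting measure, so [csummable] is
   absolute summability. *)
Definition csummable (R : realType) n (a : Zn n -> R[i]) : Prop :=
  cintegrable (@counting (Zn n) R) a.

Definition csum (R : realType) n (a : Zn n -> R[i]) : R[i] :=
  cintegral (@counting (Zn n) R) a.


Section time_frequency.
Variables (R : realType) (n : nat).
Implicit Types (j k m : Zn n) (x w xi eta omega : 'rV[R]_n).
Local Notation C := R[i].

Definition Zn_to_rV k : 'rV[R]_n := map_mx intr k.

Definition dot w k : R := \sum_(i < n) w 0 i * Zn_to_rV k 0 i.

(* an l^1 length, used only through the weights (1 + |k|)^N *)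
Definition Znorm k : R := \sum_(i < n) `|Zn_to_rV k 0 i|.

(* e^(2 pi i t) *)
Definition cis2pi (t : R) : C := cos (2 * pi * t) +i* sin (2 * pi * t).

Definition translate m (f : Zn n -> C) : Zn n -> C := fun k => f (k - m).

Definition modulate w (f : Zn n -> C) : Zn n -> C :=
  fun k => cis2pi (dot w k) * f k.

Definition inner (f g : Zn n -> C) : C := csum (fun k => f k * (g k)^*).

(* Continuous linear functionals on a space [S] of functions whose topology
   is given by the increasing family of seminorms p_N, where [bnd N B phi]
   stands for p_N(phi) <= B.  The values of [u] outside [S] are irrelevant. *)
Definition continuous_linear_on (X : Type) (S : set (X -> C))
    (bnd : nat -> R -> (X -> C) -> Prop) (u : (X -> C) -> C) : Prop :=
  (forall a phi psi, S phi -> S psi ->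
     u (a *: phi + psi) = a * u phi + u psi) /\
  (exists N (K : R), forall phi, S phi ->
     forall B : R, bnd N B phi -> normc (u phi) <= K * B).

Definition seminorm_leZ (N : nat) (B : R) (phi : Zn n -> C) : Prop :=
  forall k, (1 + Znorm k) ^+ N * normc (phi k) <= B.

Definition schwartzZ : set (Zn n -> C) :=
  [set phi | forall N, exists B, seminorm_leZ N B phi].

(* Every element of S'(Z^n) is phi |-> \sum_k f k * phi k for a unique
   function f on Z^n, with which it is identified. *)
Definition temperedZ : set (Zn n -> C) :=
  [set f | (forall phi, schwartzZ phi -> csummable (fun k => f k * phi k)) /\
     continuous_linear_on schwartzZ seminorm_leZ
       (fun phi => csum (fun k => f k * phi k))].

(* iterated partial derivative along the coordinates listed in [s] *)
Definition partial (s : seq 'I_n) (f : 'rV[R]_n -> R) : 'rV[R]_n -> R :=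
  foldr (fun i h => 'D_(delta_mx 0 i) h) f s.

Definition smooth (f : 'rV[R]_n -> R) : Prop :=
  forall s, continuous (partial s f) /\
            forall i x, derivable (partial s f) x (delta_mx 0 i).

Definition cpartial (s : seq 'I_n) (f : 'rV[R]_n -> C) : 'rV[R]_n -> C :=
  fun x => partial s (fun y => complex.Re (f y)) x +i* partial s (fun y => complex.Im (f y)) x.

Definition csmooth (f : 'rV[R]_n -> C) : Prop :=
  smooth (fun y => complex.Re (f y)) /\ smooth (fun y => complex.Im (f y)).

(* F, defined on Z^n x R^n, is a function on Z^n x T^n *)
Definition periodicZT (F : Zn n * 'rV[R]_n -> C) : Prop :=
  forall j eta k, F (j, eta + Zn_to_rV k) = F (j, eta).

Definition seminorm_leZT (N : nat) (B : R) (phi : Zn n * 'rV[R]_n -> C)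
    : Prop :=
  forall s : seq 'I_n, (size s <= N)%N -> forall j eta,
    (1 + Znorm j) ^+ N * normc (cpartial s (fun x => phi (j, x)) eta) <= B.

Definition schwartzZT : set (Zn n * 'rV[R]_n -> C) :=
  [set phi | [/\ periodicZT phi,
                 forall j, csmooth (fun eta => phi (j, eta)) &
                 forall N, exists B, seminorm_leZT N B phi]].

(* the functions F on Z^n x T^n defining a tempered distribution
   phi |-> \int F phi *)
Definition temperedZT : set (Zn n * 'rV[R]_n -> C) :=
  [set F | [/\ periodicZT F, cmeasurable F,
     forall phi, schwartzZT phi ->
       cintegrable (haarZT R n) (fun y => F y * phi y) &
     continuous_linear_on schwartzZT seminorm_leZT
       (fun phi => cintegral (haarZT R n) (fun y => F y * phi y))]].

Definition stftZ (g f : Zn n -> C) (y : Zn n * 'rV[R]_n) : C :=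
  let: (m, w) := y in inner f (modulate w (translate m g)).

Definition MnormZ (g : Zn n -> C) (p : R) (f : Zn n -> C) : \bar R :=
  cLnorm (haarZT R n) p (stftZ g f).

Definition MZ (g : Zn n -> C) (p : R) : set (Zn n -> C) :=
  [set f | temperedZ f /\ inLp (haarZT R n) p (stftZ g f)].

Definition stftZT (G F : Zn n * 'rV[R]_n -> C)
    (y : (Zn n * 'rV[R]_n) * ('rV[R]_n * Zn n)) : C :=
  let: ((m, omega), (xi, k)) := y in
  csum (fun j => cintegral (haar R n) (fun eta =>
    cis2pi (- dot xi j) * cis2pi (- dot eta k) *
    F (j, eta) * (G (j - m, eta - omega))^*)).

(* Functions only: since M^1(Z^n x T^n) is contained in L^1(Z^n x T^n), for
   p = 1 this is the whole modulation space. *)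
Definition MZT (G : Zn n * 'rV[R]_n -> C) (p : R)
    : set (Zn n * 'rV[R]_n -> C) :=
  [set F | temperedZT F /\ inLp (haarZTTZ R n) p (stftZT G F)].

Section localization.
Variables (g1 g2 : Zn n -> C) (sigma : Zn n * 'rV[R]_n -> C).

Let integrand (f : Zn n -> C) k m w : C :=
  sigma (m, w) * stftZ g1 f (m, w) * modulate w (translate m g2) k.

Definition locop (f : Zn n -> C) : Zn n -> C := fun k =>
  csum (fun m => cintegral (haar R n) (fun w => integrand f k m w)).

(* absolute convergence of all the sums and integrals in [locop f] *)
Definition locop_defined (f : Zn n -> C) : Prop :=
  [/\ forall m w,
        csummable (fun k => f k * (modulate w (translate m g1) k)^*),
      forall k m, cintegrable (haar R n) (fun w => integrand f k m w) &
      forall k,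
        csummable (fun m => cintegral (haar R n) (fun w => integrand f k m w))].

End localization.

End time_frequency.

(* [A] with the topology of the norm [N] *)

Definition normed_set (R : realType) (V : zmodType) (A : set V)
  (N : V -> \bar R) : Type := set_type A.

Section normed_set_topology.
Variables (R : realType) (V : zmodType) (A : set V) (N : V -> \bar R).

HB.instance Definition _ := Choice.copy (normed_set A N) (set_type A).

Definition norm_open : set_system (normed_set A N) :=
  [set U | forall x, U x -> exists2 e : R, 0 < e &
     forall y : normed_set A N, (N (\val y - \val x) < e%:E)%E -> U y].

Let norm_openT : norm_open setT.
Proof. by move=> x _; exists 1. Qed.

Let norm_openI : setI_closed norm_open.
Proof.
move=> U W oU oW x [/oU[e e0 eU] /oW[e' e'0 eW]].
exists (Num.min e e'); first by rewrite lt_min e0.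
move=> y Ny; split.
- by apply: eU; apply: lt_le_trans Ny _; rewrite lee_fin ge_min lexx.
- by apply: eW; apply: lt_le_trans Ny _; rewrite lee_fin ge_min lexx orbT.
Qed.

Let norm_open_bigU (I : Type) (f : I -> set (normed_set A N)) :
  (forall i, norm_open (f i)) -> norm_open (\bigcup_i f i).
Proof.
move=> of_ x [i _ /of_[e e0 eU]]; exists e => // y Ny.
by exists i => //; exact: eU.
Qed.

HB.instance Definition _ := isOpenTopological.Build (normed_set A N)
  norm_openT norm_openI norm_open_bigU.

End normed_set_topology.

(* [T] restricts to a compact linear operator from the normed space (A, N) to
   itself: it sends bounded sets to relatively compact sets. *)
Definition compact_operator (R : realType) (V : lmodType R[i]) (A : set V)
    (N : V -> \bar R) (T : V -> V) : Prop :=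
  [/\ forall f, A f -> A (T f),
      forall (a : R[i]) f h, A f -> A h -> T (a *: f + h) = a *: T f + T h &
      forall B : set V, B `<=` A ->
        (exists r : R, forall f, B f -> (N f <= r%:E)%E) ->
        precompact [set h : normed_set A N | exists2 f, B f & \val h = T f]].

(* Main.v *)
From HB Require Import structures.
Require Import Defs.
From mathcomp Require Import all_boot all_order all_algebra.
From mathcomp Require Import all_classical all_reals all_analysis.
From mathcomp Require Import complex measurable_realfun.
From mathcomp Require Import ring lra.

(** Z^n is discrete, so M^p(Z^n) is l^p with an equivalent norm; only the
    embeddings of l^1 into M^p and of M^p into l^oo matter here. They reduce
    the theorem to one pointwise estimate: if [f] is bounded by [A] then the
    value of the localization operator at [k] is bounded by [A * h k] for a
    fixed summable function [h] (lemmas [locop_le], [locop_bound_summable]).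
    Hence the operator sends a bounded set of M^p into a set of functions
    dominated by one summable function. Such a set is compact for the
    pointwise topology by Tychonoff, and on it the pointwise topology is finer
    than the l^1 norm topology, hence finer than the norm topology of M^p
    ([dominated_compact]).

    Embeddings. For fixed [m], the function [w |-> V_g f (m, w)] is an
    absolutely convergent trigonometric series whose coefficients are the
    numbers [f k * conj (g (k - m))]. Integrating it against characters
    recovers these coefficients, so that [f k * g k0] is bounded by the L^1
    norm of the slice [m = k - k0]; this gives M^p in l^oo
    ([MnormZ_sup_le]) and, after summation, M^1 in l^1 ([MZ1_summable]).
    Conversely [V_g u] is dominated by a convolution of [u] and [g], which
    gives l^1 in M^p ([MnormZ_le_l1]).

    The symbol. The same inversion, in the variable [xi], bounds the Fourier
    coefficients of the product of [sigma (j, .)] with a translate by [omega]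
    of the slice [G (j0, .)] of the window. Their Fourier transform in [omega]
    is a Fourier coefficient of [sigma (j, .)] times a Fourier coefficient of
    [G (j0, .)]. Some coefficient of some slice of [G] is not zero, because a
    Lipschitz function on the torus whose Fourier coefficients vanish is zero
    ([fourier_unique], proved with the Fejer kernel). Hence the Fourier
    coefficients of [sigma (m, .)] are bounded by [s m], uniformly in the
    frequency, for a summable [s] ([symbol_coef_dominated]).

    The operator. Expanding [V_g1 f] expresses the value at [k] as the sum over
    [m] and [j] of [f j * conj (g1 (j - m)) * g2 (k - m)] times the Fourier
    coefficient of [sigma (m, .)] of index [k - j]. It is therefore bounded by
    the sup norm of [f], the l^1 norm of [g1], and the convolution of [g2] with
    [s]. *)

Set Implicit Arguments.
Unset Strict Implicit.
Unset Printing Implicit Defensive.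
Import Order.TTheory GRing.Theory Num.Theory.
Import numFieldNormedType.Exports.
Import Normc.
Local Open Scope classical_set_scope.
Local Open Scope complex_scope.
Local Open Scope ring_scope.

(** * Complex-valued integrals *)

Section complex_modulus.
Variable R : realType.
Implicit Types z : R[i].

Lemma complex_ext z1 z2 : complex.Re z1 = complex.Re z2 ->
  complex.Im z1 = complex.Im z2 -> z1 = z2.
Proof. by case: z1 z2 => ? ? [] ? ? /= -> ->. Qed.

Lemma normc_ge0 z : 0 <= normc z.
Proof. by case: z => a b; exact: sqrtr_ge0. Qed.

Lemma normc_conj z : normc z^* = normc z.
Proof.
by case: z => a b; rewrite -[LHS]/(Num.sqrt (a ^+ 2 + (- b) ^+ 2)) sqrrN.
Qed.

Lemma normc_eq0 z : (normc z == 0) = (z == 0).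
Proof.
by apply/eqP/eqP => [|->]; [exact: eq0_normc|exact: normc0].
Qed.

Lemma normc_Re_le z : `|complex.Re z| <= normc z.
Proof.
case: z => a b /=; rewrite -(sqrtr_sqr a).
by rewrite ler_wsqrtr // lerDl sqr_ge0.
Qed.

Lemma normc_Im_le z : `|complex.Im z| <= normc z.
Proof.
case: z => a b /=; rewrite -(sqrtr_sqr b).
by rewrite ler_wsqrtr // lerDr sqr_ge0.
Qed.

Lemma normc_le_ReIm z : normc z <= `|complex.Re z| + `|complex.Im z|.
Proof.
case: z => a b /=; rewrite -(@ler_pXn2r _ 2) ?nnegrE ?sqrtr_ge0 ?addr_ge0//.
rewrite sqr_sqrtr ?addr_ge0 ?sqr_ge0// sqrrD !real_normK ?num_real//.
by rewrite lerD2r lerDl mulrn_wge0// mulr_ge0.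
Qed.

Lemma normc_real (a : R) : normc a%:C = `|a|.
Proof. by rewrite /= expr0n addr0 sqrtr_sqr. Qed.

Lemma normc_sqr z : normc z ^+ 2 = complex.Re z ^+ 2 + complex.Im z ^+ 2.
Proof. by case: z => a b /=; rewrite sqr_sqrtr ?addr_ge0 ?sqr_ge0. Qed.

Lemma mulc_conj z : z * z^* = (normc z ^+ 2)%:C.
Proof.
case: z => a b; rewrite normc_sqr; apply: complex_ext => /=; ring.
Qed.

Lemma ReD z1 z2 : complex.Re (z1 + z2) = complex.Re z1 + complex.Re z2.
Proof. by case: z1 z2 => ? ? []. Qed.

Lemma ImD z1 z2 : complex.Im (z1 + z2) = complex.Im z1 + complex.Im z2.
Proof. by case: z1 z2 => ? ? []. Qed.

Lemma ReM z1 z2 : complex.Re (z1 * z2) =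
  complex.Re z1 * complex.Re z2 - complex.Im z1 * complex.Im z2.
Proof. by case: z1 z2 => ? ? []. Qed.

Lemma ImM z1 z2 : complex.Im (z1 * z2) =
  complex.Re z1 * complex.Im z2 + complex.Im z1 * complex.Re z2.
Proof. by case: z1 z2 => ? ? [] ? ? /=; rewrite addrC; ring. Qed.

Lemma ReN z : complex.Re (- z) = - complex.Re z.
Proof. by case: z. Qed.

Lemma ImN z : complex.Im (- z) = - complex.Im z.
Proof. by case: z. Qed.

Lemma Re_conj z : complex.Re z^* = complex.Re z.
Proof. by case: z. Qed.

Lemma Im_conj z : complex.Im z^* = - complex.Im z.
Proof. by case: z. Qed.

Lemma conjcM z1 z2 : (z1 * z2)^* = z1^* * z2^*.
Proof. exact: rmorphM. Qed.

Lemma conjc_sum (I : Type) (r : seq I) (F : I -> R[i]) :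
  (\sum_(i <- r) F i)^* = \sum_(i <- r) (F i)^*.
Proof. exact: rmorph_sum. Qed.

Lemma conjc_realc (a : R) : (a%:C)^* = a%:C.
Proof. exact: conjc_real. Qed.

Lemma real_complexM (a b : R) : (a * b)%:C = a%:C * b%:C.
Proof. exact: rmorphM. Qed.

End complex_modulus.

Section complex_measurability.
Context d (T : measurableType d) (R : realType).
Implicit Types f g : T -> R[i].

Lemma cmeasurable_cst (z : R[i]) : cmeasurable (fun _ : T => z).
Proof. by split; exact: measurable_cst. Qed.

Lemma cmeasurableD f g : cmeasurable f -> cmeasurable g ->
  cmeasurable (fun x => f x + g x).
Proof.
move=> [mf1 mf2] [mg1 mg2]; split.
- by under eq_fun do rewrite ReD; exact: measurable_funD.
- by under eq_fun do rewrite ImD; exact: measurable_funD.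
Qed.

Lemma cmeasurableM f g : cmeasurable f -> cmeasurable g ->
  cmeasurable (fun x => f x * g x).
Proof.
move=> [mf1 mf2] [mg1 mg2]; split.
- by under eq_fun do rewrite ReM; apply: measurable_funB; exact: measurable_funM.
- by under eq_fun do rewrite ImM; apply: measurable_funD; exact: measurable_funM.
Qed.

Lemma cmeasurable_conj f : cmeasurable f -> cmeasurable (fun x => (f x)^*).
Proof.
move=> [mf1 mf2]; split; first by under eq_fun do rewrite Re_conj.
by under eq_fun do rewrite Im_conj; exact: measurableT_comp.
Qed.

Lemma cmeasurable_comp d' (T' : measurableType d') (h : T' -> T) f :
  cmeasurable f -> measurable_fun setT h -> cmeasurable (f \o h).
Proof.
move=> [mf1 mf2] mh; split.
- exact: (measurableT_comp (f := fun x => complex.Re (f x))).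
- exact: (measurableT_comp (f := fun x => complex.Im (f x))).
Qed.

Lemma measurable_normc f : cmeasurable f ->
  measurable_fun setT (fun x => normc (f x)).
Proof.
move=> [mf1 mf2].
rewrite (_ : (fun x => _) = fun x =>
    Num.sqrt (complex.Re (f x) ^+ 2 + complex.Im (f x) ^+ 2)).
  apply: (@measurableT_comp _ _ _ _ _ _ (@Num.sqrt R)).
    by apply: continuous_measurable_fun; exact: sqrt_continuous.
  by apply: measurable_funD; exact: measurable_funX.
by apply/funext => x; case: (f x).
Qed.

Lemma measurable_normcE f : cmeasurable f ->
  measurable_fun setT (fun x => (normc (f x))%:E).
Proof. by move=> mf; apply/measurable_EFinP; exact: measurable_normc. Qed.

End complex_measurability.

Section complex_integral_theory.
Context d (T : measurableType d) (R : realType).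
Variable mu : {measure set T -> \bar R}.
Implicit Types (f g : T -> R[i]) (b : T -> R).
Local Open Scope ereal_scope.

Lemma cintegrable_cmeasurable f : cintegrable mu f -> cmeasurable f.
Proof.
move=> [/integrableP[mf1 _] /integrableP[mf2 _]].
by split; exact/measurable_EFinP.
Qed.

Lemma cintegrable_le f b : cmeasurable f ->
  mu.-integrable setT (fun x => (b x)%:E) ->
  (forall x, normc (f x) <= b x)%R -> cintegrable mu f.
Proof.
move=> [mf1 mf2] ib fb; split.
- apply: (le_integrable measurableT _ _ ib).
    exact/measurable_EFinP.
  move=> x _; rewrite /= lee_fin [leRHS]ger0_norm.
    by rewrite (le_trans (normc_Re_le _))// (le_trans (fb x)).
  by rewrite (le_trans _ (fb x))// normc_ge0.
- apply: (le_integrable measurableT _ _ ib).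
    exact/measurable_EFinP.
  move=> x _; rewrite /= lee_fin [leRHS]ger0_norm.
    by rewrite (le_trans (normc_Im_le _))// (le_trans (fb x)).
  by rewrite (le_trans _ (fb x))// normc_ge0.
Qed.

Lemma cintegrableP f : cintegrable mu f <->
  cmeasurable f /\ \int[mu]_x (normc (f x))%:E < +oo.
Proof.
split=> [cf|[mf foo]].
  have mf := cintegrable_cmeasurable cf; split => //.
  case: cf => /integrableP[_ i1] /integrableP[_ i2].
  apply: (@le_lt_trans _ _ (\int[mu]_x (`|(complex.Re (f x))%:E| +
      `|(complex.Im (f x))%:E|))).
    apply: ge0_le_integral => //.
    - by move=> x _; rewrite lee_fin normc_ge0.
    - exact: measurable_normcE.
    - by case: mf => mf1 mf2; apply: emeasurable_funD;
        apply: measurableT_comp => //; exact/measurable_EFinP.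
    - by move=> x _; rewrite lee_fin normc_le_ReIm.
  case: mf => mf1 mf2; rewrite ge0_integralD//; first exact: lte_add_pinfty.
    by apply: measurableT_comp => //; exact/measurable_EFinP.
  by apply: measurableT_comp => //; exact/measurable_EFinP.
apply: (@cintegrable_le _ (fun x => normc (f x))) => //.
apply/integrableP; split; first exact: measurable_normcE.
by under eq_integral do rewrite /= ger0_norm ?normc_ge0//.
Qed.

Lemma integrable_normc f : cintegrable mu f ->
  mu.-integrable setT (fun x => (normc (f x))%:E).
Proof.
move=> /cintegrableP[mf foo]; apply/integrableP; split.
  exact: measurable_normcE.
by under eq_integral do rewrite /= ger0_norm ?normc_ge0//.
Qed.

Lemma cintegrable_normc_le f g : cmeasurable f -> cintegrable mu g ->
  (forall x, normc (f x) <= normc (g x))%R -> cintegrable mu f.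
Proof. by move=> mf /integrable_normc; exact: cintegrable_le. Qed.

Lemma cintegrableD f g : cintegrable mu f -> cintegrable mu g ->
  cintegrable mu (fun x => f x + g x)%R.
Proof.
move=> [f1 f2] [g1 g2]; split.
- rewrite (_ : (fun x => _) = (fun x => (complex.Re (f x))%:E) \+
    (fun x => (complex.Re (g x))%:E)); first exact: integrableD.
  by apply/funext => x; rewrite ReD.
- rewrite (_ : (fun x => _) = (fun x => (complex.Im (f x))%:E) \+
    (fun x => (complex.Im (g x))%:E)); first exact: integrableD.
  by apply/funext => x; rewrite ImD.
Qed.

Lemma cintegrableZ (a : R[i]) f : cintegrable mu f ->
  cintegrable mu (fun x => a * f x)%R.
Proof.
move=> cf; apply: (@cintegrable_le _ (fun x => normc a * normc (f x))%R).
- exact: (cmeasurableM (cmeasurable_cst _ a) (cintegrable_cmeasurable cf)).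
- under eq_fun do rewrite EFinM.
  by apply: integrableZl => //; exact: integrable_normc.
- by move=> x; rewrite normcM.
Qed.

Lemma cintegralD f g : cintegrable mu f -> cintegrable mu g ->
  cintegral mu (fun x => f x + g x)%R = (cintegral mu f + cintegral mu g)%R.
Proof.
move=> [f1 f2] [g1 g2]; apply: complex_ext; rewrite /cintegral /=.
- by under eq_Rintegral do rewrite ReD; exact: RintegralD.
- by under eq_Rintegral do rewrite ImD; exact: RintegralD.
Qed.

Lemma cintegralZ (a : R[i]) f : cintegrable mu f ->
  cintegral mu (fun x => a * f x)%R = (a * cintegral mu f)%R.
Proof.
move=> [f1 f2]; case: a => a1 a2; apply: complex_ext; rewrite /cintegral /=.
- under eq_Rintegral do rewrite ReM /=.
  rewrite RintegralB//.
  + by rewrite !RintegralZl.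
  + by rewrite /comp; under eq_fun do rewrite EFinM; exact: integrableZl.
  + by rewrite /comp; under eq_fun do rewrite EFinM; exact: integrableZl.
- under eq_Rintegral do rewrite ImM /=.
  rewrite RintegralD//.
  + by rewrite !RintegralZl.
  + by rewrite /comp; under eq_fun do rewrite EFinM; exact: integrableZl.
  + by rewrite /comp; under eq_fun do rewrite EFinM; exact: integrableZl.
Qed.

Lemma cintegral0 : cintegral mu (fun _ => 0%R) = 0%R.
Proof. by rewrite /cintegral /= /Rintegral integral0. Qed.

Lemma eq_cintegral f g : f =1 g -> cintegral mu f = cintegral mu g.
Proof. by move=> /funext ->. Qed.

Lemma cintegrable0 : cintegrable mu (fun _ => 0%R).
Proof. by split; exact: integrable0. Qed.

Lemma cintegrable_sum (I : Type) (s : seq I) (F : I -> T -> R[i]) :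
  (forall i, cintegrable mu (F i)) ->
  cintegrable mu (fun x => \sum_(i <- s) F i x)%R.
Proof.
move=> cF; elim: s => [|i s ih].
  by under eq_fun do rewrite big_nil; exact: cintegrable0.
by under eq_fun do rewrite big_cons; exact: cintegrableD.
Qed.

Lemma cintegral_sum (I : Type) (s : seq I) (F : I -> T -> R[i]) :
  (forall i, cintegrable mu (F i)) ->
  cintegral mu (fun x => \sum_(i <- s) F i x)%R =
  (\sum_(i <- s) cintegral mu (F i))%R.
Proof.
move=> cF; elim: s => [|i s ih].
  by under eq_cintegral do rewrite big_nil; rewrite big_nil cintegral0.
under eq_cintegral do rewrite big_cons.
by rewrite big_cons -ih cintegralD//; exact: cintegrable_sum.
Qed.

(** The modulus of [z := cintegral mu f] is the integral of the real part of
    [f] rotated by the conjugate phase of [z]. *)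
Lemma normc_cintegral_le f : cmeasurable f ->
  (normc (cintegral mu f))%:E <= \int[mu]_x (normc (f x))%:E.
Proof.
move=> mf; have [foo|] := ltP (\int[mu]_x (normc (f x))%:E) +oo; last first.
  by rewrite leye_eq => /eqP ->; exact: leey.
have cf : cintegrable mu f by apply/cintegrableP.
set z := cintegral mu f.
have [z0|z0] := eqVneq z 0%R.
  by rewrite z0 normc0 integral_ge0// => x _; rewrite lee_fin normc_ge0.
have nz : (0 < normc z)%R by rewrite lt_neqAle normc_ge0 eq_sym normc_eq0 z0.
have czf := cintegrableZ (z^*) cf.
have zE : (normc z ^+ 2 = \int[mu]_x complex.Re (z^* * f x))%R.
  have := cintegralZ (z^*) cf; rewrite -/z mulrC mulc_conj.
  by move=> /(congr1 (@complex.Re R)) /=.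
have : ((normc z ^+ 2)%:E <= \int[mu]_x (normc z * normc (f x))%:E).
  rewrite zE /Rintegral fineK; last first.
    by apply: integrable_fin_num => //; case: czf.
  apply: le_integral => //; first by case: czf.
    under eq_fun do rewrite EFinM.
    by apply: integrableZl => //; exact: integrable_normc.
  move=> x _; rewrite lee_fin (le_trans (ler_norm _))//.
  by rewrite (le_trans (normc_Re_le _))// normcM normc_conj.
under eq_integral do rewrite EFinM.
rewrite ge0_integralZl//; last 3 first.
- exact: measurable_normcE.
- by move=> x _; rewrite lee_fin normc_ge0.
- by rewrite lee_fin normc_ge0.
by rewrite expr2 EFinM lee_pmul2l.
Qed.

Lemma normc_cintegral_bound f (b : R) : cintegrable mu f ->
  \int[mu]_x (normc (f x))%:E <= b%:E -> (normc (cintegral mu f) <= b)%R.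
Proof.
move=> cf; rewrite -lee_fin; apply: le_trans.
exact/normc_cintegral_le/cintegrable_cmeasurable.
Qed.

End complex_integral_theory.

Section complex_fubini.
Local Open Scope ereal_scope.
Context d1 d2 (T1 : measurableType d1) (T2 : measurableType d2) (R : realType).
Variable m1 : {sigma_finite_measure set T1 -> \bar R}.
Variable m2 : {sigma_finite_measure set T2 -> \bar R}.
Implicit Type F : T1 * T2 -> R[i].

Lemma measurable_Rintegral_r (f : T1 * T2 -> R) : measurable_fun setT f ->
  measurable_fun setT (fun x => \int[m2]_y f (x, y))%R.
Proof.
move=> mf; apply: (measurableT_comp (f := fine)); first exact: fine_measurable.
under eq_fun do rewrite integralE.
have mEf : measurable_fun setT (EFin \o f) by exact/measurable_EFinP.
under eq_fun do under eq_integral do rewrite funeposE.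
under eq_fun do under [X in _ - X]eq_integral do rewrite funenegE.
apply: emeasurable_funB.
- apply: (measurable_fun_fubini_tonelli_F (fun z => maxe (f z)%:E 0)).
    exact: measurable_maxe.
  by move=> z; rewrite le_max lexx orbT.
- apply: (measurable_fun_fubini_tonelli_F (fun z => maxe (- (f z)%:E) 0)).
    by apply: measurable_maxe => //; exact: measurableT_comp.
  by move=> z; rewrite le_max lexx orbT.
Qed.

Lemma cmeasurable_cintegral_r F : cmeasurable F ->
  cmeasurable (fun x => cintegral m2 (fun y => F (x, y))).
Proof.
move=> [mF1 mF2]; split.
- exact: (measurable_Rintegral_r (f := fun z => complex.Re (F z))).
- exact: (measurable_Rintegral_r (f := fun z => complex.Im (F z))).
Qed.

(** Domination by a product of integrable functions of one variable makes all
    the sections integrable, so that the exchange needs no almost everywhere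
    precaution. *)
Lemma cFubini F (a : T1 -> R) (b : T2 -> R) : cmeasurable F ->
  m1.-integrable setT (fun x => (a x)%:E) ->
  m2.-integrable setT (fun y => (b y)%:E) ->
  (forall x, 0 <= a x)%R -> (forall y, 0 <= b y)%R ->
  (forall x y, normc (F (x, y)) <= a x * b y)%R ->
  cintegral m1 (fun x => cintegral m2 (fun y => F (x, y))) =
  cintegral m2 (fun y => cintegral m1 (fun x => F (x, y))).
Proof.
move=> mF ia ib a0 b0 Fab.
have iF : cintegrable (m1 \x m2) F.
  have ma := measurable_int _ ia; have mb := measurable_int _ ib.
  have mE : measurable_fun setT (fun z : T1 * T2 => (a z.1)%:E * (b z.2)%:E).
    apply: emeasurable_funM.
    - exact: (measurableT_comp (f := fun x => (a x)%:E)).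
    - exact: (measurableT_comp (f := fun x => (b x)%:E)).
  apply: (@cintegrable_le _ _ _ _ _ (fun z => a z.1 * b z.2)%R) => //; last first.
    by case=> x y; exact: Fab.
  under eq_fun do rewrite EFinM.
  apply/integrableP; split => //.
  under eq_integral do
    rewrite gee0_abs ?mule_ge0// ?lee_fin ?a0 ?b0//.
  rewrite fubini_tonelli1//; last first.
      by case=> x y; rewrite mule_ge0// lee_fin ?a0 ?b0.
  rewrite /fubini_F /=.
  rewrite (eq_integral (fun x => (a x)%:E * \int[m2]_y (b y)%:E)); last first.
    by move=> x _; rewrite ge0_integralZl ?lee_fin// => y _; rewrite lee_fin.
  have ab0 : 0 <= \int[m2]_y (b y)%:E by apply: integral_ge0 => y _; rewrite lee_fin.
  have /fineK <- : \int[m2]_y (b y)%:E \is a fin_num.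
    exact: integrable_fin_num.
  have /fineK iaE : \int[m1]_x (a x)%:E \is a fin_num.
    exact: integrable_fin_num.
  rewrite ge0_integralZr//; last by rewrite lee_fin fine_ge0.
    by rewrite -iaE -EFinM ltry.
  by move=> x _; rewrite lee_fin.
have mFx x : cmeasurable (fun y => F (x, y)).
  by apply: (cmeasurable_comp (f := F)) => //; exact: pair1_measurable.
have mFy y : cmeasurable (fun x => F (x, y)).
  by apply: (cmeasurable_comp (f := F)) => //; exact: pair2_measurable.
have iFx x : cintegrable m2 (fun y => F (x, y)).
  apply: (@cintegrable_le _ _ _ _ _ (fun y => a x * b y)%R) => //.
  by under eq_fun do rewrite EFinM; exact: integrableZl.
have iFy y : cintegrable m1 (fun x => F (x, y)).
  apply: (@cintegrable_le _ _ _ _ _ (fun x => a x * b y)%R) => //.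
  by under eq_fun do rewrite EFinM; exact: integrableZr.
apply: complex_ext; rewrite /cintegral/= /Rintegral; congr fine.
- transitivity (\int[m1]_x \int[m2]_y (complex.Re (F (x, y)))%:E).
    apply: eq_integral => x _; rewrite fineK// integrable_fin_num//.
    by case: (iFx x).
  rewrite (Fubini (f := fun z => (complex.Re (F z))%:E)); last by case: iF.
  apply: eq_integral => y _; rewrite fineK// integrable_fin_num//.
  by case: (iFy y).
- transitivity (\int[m1]_x \int[m2]_y (complex.Im (F (x, y)))%:E).
    apply: eq_integral => x _; rewrite fineK// integrable_fin_num//.
    by case: (iFx x).
  rewrite (Fubini (f := fun z => (complex.Im (F z))%:E)); last by case: iF.
  apply: eq_integral => y _; rewrite fineK// integrable_fin_num//.
  by case: (iFy y).
Qed.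

End complex_fubini.

(** * Translation invariance of the Haar measure of the torus *)

Section circle_shift.
Variable R : realType.
Local Open Scope ereal_scope.
Implicit Type f : R -> \bar R.

Let measurable_shift (c : R) :
  measurable_fun [set: measurableTypeR R] ((fun x => x + c)%R : _ -> measurableTypeR R).
Proof.
apply: continuous_measurable_fun => x.
by apply: cvgD; [exact: cvg_id|exact: cvg_cst].
Qed.

Lemma lebesgue_measure_shift (c : R) (A : set (measurableTypeR R)) :
  measurable A ->
  lebesgue_measure A = pushforward lebesgue_measure
    ((fun x => x + c)%R : measurableTypeR R -> measurableTypeR R) A.
Proof.
pose phi := ((fun x => x + c)%R : measurableTypeR R -> measurableTypeR R).
pose H := isMeasurableFun.Build _ _ _ _ phi (measurable_shift c).
pose phi' : {mfun measurableTypeR R >-> measurableTypeR R} := HB.pack phi H.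
move=> mA.
apply: (@lebesgue_measure_unique _ (pushforward lebesgue_measure phi')) => //.
move=> _ [[a b] _ <-]; rewrite /pushforward /=.
have E : phi @^-1` `]a, b] = `](a - c)%R, (b - c)%R]%classic.
  by apply/seteqP; split => x /=; rewrite /phi !in_itv /= ltrBlDr lerBrDr.
rewrite [RHS](congr1 lebesgue_measure E).
rewrite !lebesgue_measure_itv /= !lte_fin ltrD2r; case: ifP => // _.
by rewrite -!EFinD; congr EFin; ring.
Qed.

Lemma integral_shift (c : R) (D : set R) f : measurable D ->
  measurable_fun [set: R] f -> (forall x, 0 <= f x) ->
  \int[lebesgue_measure]_(x in [set x | D (x + c)%R]) f (x + c)%R =
  \int[lebesgue_measure]_(x in D) f x.
Proof.
move=> mD mf f0.
pose phi := ((fun x => x + c)%R : measurableTypeR R -> measurableTypeR R).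
pose H := isMeasurableFun.Build _ _ _ _ phi (measurable_shift c).
pose phi' : {mfun measurableTypeR R >-> measurableTypeR R} := HB.pack phi H.
rewrite [RHS](@eq_measure_integral _ _ _ _ (pushforward lebesgue_measure phi')).
  by rewrite ge0_integral_pushforward//; exact: measurable_funTS.
by move=> A mA _; exact: lebesgue_measure_shift.
Qed.

(** The interval [c, 1 + c[ splits at 1 into two pieces whose translates tile
    [0, 1[. *)
Lemma integral_periodic_shift (a : R) f : measurable_fun [set: R] f ->
  (forall x, 0 <= f x) -> (forall x (k : int), f (x + k%:~R)%R = f x) ->
  \int[lebesgue_measure]_(x in `[0%R, 1%R]) f (x + a)%R =
  \int[lebesgue_measure]_(x in `[0%R, 1%R]) f x.
Proof.
move=> mf f0 fper.
pose c := (a - (Num.floor a)%:~R)%R.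
have /andP[c0 c1] : (0 <= c < 1)%R.
  have := floor_itv a; rewrite /c intrD; lra.
have mfa : measurable_fun [set: R] (fun x => f (x + a)%R).
  by apply: (measurableT_comp mf); exact: measurable_shift.
rewrite -!integral_itv_bndo_bndc; [|exact: measurable_funTS..].
transitivity (\int[lebesgue_measure]_(x in [set x | `[c, (1 + c)%R[%classic (x + c)%R])
    f (x + c)%R).
  have -> : [set x | `[c, (1 + c)%R[%classic (x + c)%R] = `[0%R, 1%R[%classic.
    by apply/seteqP; split => x /=; rewrite !in_itv /=; lra.
  apply: eq_integral => x _; rewrite -(fper (x + c)%R (Num.floor a)).
  by congr f; rewrite /c; ring.
rewrite integral_shift//.
have -> : `[c, (1 + c)%R[%classic = `[c, 1%R[ `|` `[1%R, (1 + c)%R[.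
  by apply/seteqP; split => x /=; rewrite !in_itv /=; lra.
have -> : `[0%R, 1%R[%classic = `[c, 1%R[ `|` `[0%R, c[.
  by apply/seteqP; split => x /=; rewrite !in_itv /=; lra.
rewrite !ge0_integral_setU//; try exact: measurable_funTS; last 2 first.
- apply/disj_setPS => x [] /=; rewrite !in_itv /=; lra.
- apply/disj_setPS => x [] /=; rewrite !in_itv /=; lra.
congr (_ + _); rewrite -(@integral_shift 1%R)//.
have -> : [set x | `[1%R, (1 + c)%R[%classic (x + 1)%R] = `[0%R, c[%classic.
  by apply/seteqP; split => x /=; rewrite !in_itv /=; lra.
by apply: eq_integral => x _; rewrite -[RHS](fper x 1%R).
Qed.

End circle_shift.

Section haar_shift.
Variable R : realType.
Local Open Scope ereal_scope.

Lemma measurable_rV_shift n (a : 'rV[R]_n) :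
  measurable_fun setT (fun x : 'rV[R]_n => (x + a)%R).
Proof.
apply: measurable_fun_rV => i; under eq_fun do rewrite mxE.
by apply: measurable_funD => //; exact: measurable_coor.
Qed.

Lemma cons_rV_add n (x1 a1 : R) (x a : 'rV[R]_n) :
  (cons_rV (x1, x) + cons_rV (a1, a))%R = cons_rV ((x1 + a1)%R, (x + a)%R).
Proof.
by rewrite /cons_rV /= (@add_row_mx _ 1 1 n) raddfD.
Qed.

Definition cons_Zn n (z : int) (k : Zn n) : Zn n.+1 :=
  row_mx (z%:M : 'M[int]_1) k : 'rV[int]_(1 + n).

Lemma Zn_to_rV_cons n (z : int) (k : Zn n) :
  Zn_to_rV R (cons_Zn z k) = cons_rV (z%:~R%R, Zn_to_rV R k).
Proof.
rewrite /Zn_to_rV /cons_Zn /cons_rV (@map_row_mx _ _ _ 1 1 n) /=.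
by rewrite map_scalar_mx.
Qed.

Lemma cons_rV_eta n (x : 'rV[R]_n.+1) :
  x = cons_rV (x 0 0, \row_i x 0 (lift ord0 i))%R.
Proof.
apply/rowP => i; rewrite /cons_rV; have [j ->|j ->] := @split_ordP 1 n i.
- rewrite (@row_mxEl _ 1 1 n) ord1 /= mxE eqxx mulr1n; congr (x _ _).
  exact/val_inj.
- rewrite (@row_mxEr _ 1 1 n) /= mxE; congr (x _ _); exact/val_inj.
Qed.

Lemma ge0_integral_haarS n (f : 'rV[R]_n.+1 -> \bar R) :
  measurable_fun setT f -> (forall x, 0 <= f x) ->
  \int[haar R n.+1]_x f x =
  \int[lebesgue_measure]_(x1 in `[0%R, 1%R])
     \int[haar R n]_x f (cons_rV (x1, x)).
Proof.
move=> mf f0; rewrite /= ge0_integral_distribution//.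
have mfc := measurableT_comp mf (@measurable_cons_rV R n).
rewrite (@fubini_tonelli1 _ _ _ _ _ (uniform_prob (@ltr01 R)))//;
  last by move=> x; exact: f0.
rewrite integral_uniform//.
- by rewrite subr0 invr1 mul1e.
- exact: (measurable_fun_fubini_tonelli_F (f \o @cons_rV R n) mfc (fun=> f0 _)).
- by move=> x; apply: integral_ge0 => y _; exact: f0.
Qed.

(** One coordinate at a time: the inner integral over the remaining
    coordinates is again a periodic function of the first one. *)
Lemma ge0_integral_haar_shift n (a : 'rV[R]_n) (f : 'rV[R]_n -> \bar R) :
  measurable_fun setT f -> (forall x, 0 <= f x) ->
  (forall x k, f (x + Zn_to_rV R k)%R = f x) ->
  \int[haar R n]_x f (x + a)%R = \int[haar R n]_x f x.
Proof.
elim: n a f => [|n ih] a f mf f0 fper.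
  by apply: eq_integral => x _; rewrite [(x + a)%R]thinmx0 [x]thinmx0.
rewrite !ge0_integral_haarS//; last first.
  exact: (measurableT_comp mf (@measurable_rV_shift _ a)).
rewrite (cons_rV_eta a); set a1 := a 0%R 0%R; set a' := \row_i _.
have mfc := measurableT_comp mf (@measurable_cons_rV R n).
pose phi (x1 : R) := \int[haar R n]_x f (cons_rV (x1, x)).
transitivity (\int[lebesgue_measure]_(x1 in `[0%R, 1%R]) phi (x1 + a1)%R).
  apply: eq_integral => x1 _; rewrite /phi.
  under eq_integral do rewrite cons_rV_add.
  apply: (ih a' (fun x => f (cons_rV ((x1 + a1)%R, x)))) => //.
  - exact: (measurableT_comp mfc (pair1_measurable _)).
  - move=> x k; rewrite -[RHS](fper _ (cons_Zn 0%R k)) Zn_to_rV_cons.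
    by rewrite cons_rV_add addr0.
apply: integral_periodic_shift.
- exact: (measurable_fun_fubini_tonelli_F (f \o @cons_rV R n) mfc (fun=> f0 _)).
- by move=> x1; apply: integral_ge0 => x _; exact: f0.
- move=> x1 k; apply: eq_integral => x _.
  rewrite -[RHS](fper _ (cons_Zn k 0%R)) Zn_to_rV_cons cons_rV_add.
  by rewrite /Zn_to_rV map_mx0 addr0.
Qed.

Lemma Rintegral_haar_shift n (a : 'rV[R]_n) (f : 'rV[R]_n -> R) :
  measurable_fun setT f -> (forall x k, f (x + Zn_to_rV R k)%R = f x) ->
  (\int[haar R n]_x f (x + a) = \int[haar R n]_x f x)%R.
Proof.
move=> mf fper; rewrite /Rintegral; congr fine; rewrite [LHS]integralE [RHS]integralE.
have mE : measurable_fun setT (fun x => (f x)%:E) by exact/measurable_EFinP.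
congr (_ - _).
- rewrite -(@ge0_integral_haar_shift _ a _ (measurable_funepos mE))//.
    by apply: eq_integral => x _; rewrite !funeposE.
  by move=> x k; rewrite !funeposE fper.
- rewrite -(@ge0_integral_haar_shift _ a _ (measurable_funeneg mE))//.
    by apply: eq_integral => x _; rewrite !funenegE.
  by move=> x k; rewrite !funenegE fper.
Qed.

Lemma cintegral_haar_shift n (a : 'rV[R]_n) (f : 'rV[R]_n -> R[i]) :
  cmeasurable f -> (forall x k, f (x + Zn_to_rV R k)%R = f x) ->
  cintegral (haar R n) (fun x => f (x + a)%R) = cintegral (haar R n) f.
Proof.
move=> [mf1 mf2] fper; apply: complex_ext => /=.
- by apply: (Rintegral_haar_shift _ mf1) => x k; rewrite fper.
- by apply: (Rintegral_haar_shift _ mf2) => x k; rewrite fper.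
Qed.

End haar_shift.

(** * Characters of the torus *)

Section characters.
Variable R : realType.
Implicit Types s t : R.

Lemma cis2piD s t : cis2pi (s + t) = cis2pi s * cis2pi t.
Proof.
apply: complex_ext; rewrite ?ReM ?ImM /= mulrDr ?cosD ?sinD//.
by rewrite addrC; congr (_ + _); rewrite mulrC.
Qed.

Lemma cis2piN t : cis2pi (- t) = (cis2pi t)^*.
Proof. by rewrite /cis2pi mulrN cosN sinN. Qed.

Lemma normc_cis2pi t : normc (cis2pi t) = 1.
Proof. by rewrite /cis2pi /= cos2Dsin2 sqrtr1. Qed.

Lemma cis2pi0 : cis2pi 0 = 1 :> R[i].
Proof. by rewrite /cis2pi mulr0 cos0 sin0. Qed.

Lemma cis2pi_half : cis2pi (2^-1) = -1 :> R[i].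
Proof.
by rewrite /cis2pi mulrAC divff ?pnatr_eq0// mul1r cospi sinpi; apply: complex_ext;
  rewrite /= ?oppr0.
Qed.

Lemma cis2pi1 : cis2pi 1 = 1 :> R[i].
Proof.
have -> : 1 = 2^-1 + 2^-1 :> R by field.
by rewrite cis2piD cis2pi_half mulrNN mulr1.
Qed.

Lemma cis2pi_int (z : int) : cis2pi z%:~R = 1 :> R[i].
Proof.
have nat m : cis2pi m%:R = 1 :> R[i].
  elim: m => [|m ih]; first exact: cis2pi0.
  by rewrite -addn1 natrD cis2piD ih cis2pi1 mulr1.
case: z => m; first exact: nat.
by rewrite NegzE mulrNz cis2piN nat rmorph1.
Qed.

Variable n : nat.
Implicit Types (w x : 'rV[R]_n) (k l : Zn n).

Lemma dotDl w x k : dot (w + x) k = dot w k + dot x k.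
Proof.
by rewrite /dot -big_split /=; apply: eq_bigr => i _; rewrite mxE mulrDl.
Qed.

Lemma dotDr w k l : dot w (k + l) = dot w k + dot w l.
Proof.
rewrite /dot -big_split /=; apply: eq_bigr => i _.
by rewrite !mxE intrD mulrDr.
Qed.

Lemma dotNr w k : dot w (- k) = - dot w k.
Proof.
by rewrite /dot -sumrN; apply: eq_bigr => i _; rewrite !mxE mulrNz mulrN.
Qed.

Lemma dot0r w : dot w 0 = 0.
Proof. by rewrite /dot big1// => i _; rewrite !mxE mulr0. Qed.

Definition echar k w : R[i] := cis2pi (dot w k).

Lemma echarDl k w x : echar k (w + x) = echar k w * echar k x.
Proof. by rewrite /echar dotDl cis2piD. Qed.

Lemma echarDr k l w : echar (k + l) w = echar k w * echar l w.
Proof. by rewrite /echar dotDr cis2piD. Qed.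

Lemma echarNr k w : echar (- k) w = (echar k w)^*.
Proof. by rewrite /echar dotNr cis2piN. Qed.

Lemma echar0 w : echar 0 w = 1.
Proof. by rewrite /echar dot0r cis2pi0. Qed.

Lemma normc_echar k w : normc (echar k w) = 1.
Proof. exact: normc_cis2pi. Qed.

Lemma echar_periodic k w l : echar k (w + Zn_to_rV R l) = echar k w.
Proof.
rewrite echarDl (_ : echar k (Zn_to_rV R l) = 1) ?mulr1//.
rewrite /echar (_ : dot _ _ = (\sum_i l 0 i * k 0 i)%:~R) ?cis2pi_int//.
rewrite /dot rmorph_sum; apply: eq_bigr => i _.
by rewrite !mxE -intrM.
Qed.

Lemma measurable_dot :
  measurable_fun setT (fun y : Zn n * 'rV[R]_n => dot y.2 y.1).
Proof.
apply: measurable_sum => i; apply: measurable_funM.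
- exact: (measurableT_comp (measurable_coor i)).
- by apply: (measurableT_comp (f := fun k : Zn n => Zn_to_rV R k 0 i)).
Qed.

Lemma cmeasurable_echar2 :
  cmeasurable (fun y : Zn n * 'rV[R]_n => echar y.1 y.2).
Proof.
split; rewrite /=.
- apply: (@measurableT_comp _ _ _ _ _ _ (fun t => cos t)).
    by apply: continuous_measurable_fun; exact: continuous_cos.
  by apply: measurable_funM => //; exact: measurable_dot.
- apply: (@measurableT_comp _ _ _ _ _ _ (fun t => sin t)).
    by apply: continuous_measurable_fun; exact: continuous_sin.
  by apply: measurable_funM => //; exact: measurable_dot.
Qed.

Lemma cmeasurable_echar k : cmeasurable (echar k).
Proof.
apply: (cmeasurable_comp (f := fun y : Zn n * 'rV[R]_n => echar y.1 y.2)
  (h := fun w => (k, w))); first exact: cmeasurable_echar2.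
exact: pair1_measurable.
Qed.

Lemma cintegrable_haar_bounded (f : 'rV[R]_n -> R[i]) (B : R) :
  cmeasurable f -> (forall w, normc (f w) <= B) -> cintegrable (haar R n) f.
Proof.
move=> mf fB; apply: (@cintegrable_le _ _ _ _ _ (fun=> B)) => //.
apply: measurable_bounded_integrable => //.
  by rewrite (le_lt_trans (probability_le1 _ _))// ltry.
exact: bounded_cst.
Qed.

Lemma cintegrable_echar k : cintegrable (haar R n) (echar k).
Proof.
apply: (@cintegrable_haar_bounded _ 1); first exact: cmeasurable_echar.
by move=> w; rewrite normc_echar.
Qed.

Lemma cintegral_haar_cst (z : R[i]) : cintegral (haar R n) (fun=> z) = z.
Proof.
have h1 : fine (haar R n setT) = 1 by rewrite probability_setT.
by apply: complex_ext; rewrite /= Rintegral_cst// h1 mulr1.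
Qed.

(** Translating by half a period in a direction where the frequency is not
    zero changes the sign of the character but not its integral. *)
Lemma cintegral_echar k :
  cintegral (haar R n) (echar k) = if k == 0 then 1 else 0.
Proof.
have [->|k0] := eqVneq k 0.
  by under eq_cintegral do rewrite echar0; exact: cintegral_haar_cst.
have [i ki0] : exists i, k 0 i != 0.
  apply/existsP; apply: contraNT k0; rewrite negb_exists => /forallP ki0.
  by apply/eqP/rowP => i; rewrite mxE; apply/eqP; rewrite -[_ == _]negbK.
pose a : 'rV[R]_n := \row_j (if j == i then (2 * (k 0 i)%:~R)^-1 else 0).
have ea : echar k a = -1.
  rewrite /echar (_ : dot a k = 2^-1) ?cis2pi_half// /dot (bigD1 i)//=.
  rewrite !mxE eqxx big1 ?addr0; last first.
    by move=> j /negbTE ji; rewrite !mxE ji mul0r.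
  by rewrite invfM -mulrA mulVf ?mulr1// intr_eq0.
have := cintegral_haar_shift a (cmeasurable_echar k) (echar_periodic k).
under eq_cintegral do rewrite echarDl ea mulrC.
rewrite cintegralZ ?mulN1r; last exact: cintegrable_echar.
move=> /eqP; rewrite eq_sym -subr_eq0 opprK -mulr2n mulrn_eq0 /=.
by move=> /eqP.
Qed.

End characters.

(** * Uniqueness of Fourier coefficients *)

Section coordinate_moduli.
Variables (R : realType) (n : nat).
Implicit Types (f : 'rV[R]_n -> R[i]) (x y : 'rV[R]_n).

(** Moving from [x] to [y] one coordinate at a time. *)
Lemma normc_sub_le_coord f (b : R -> R) :
  (forall x i t, normc (f (x + t *: delta_mx 0 i) - f x) <= b t) ->
  forall x y, normc (f y - f x) <= \sum_i b (y 0 i - x 0 i).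
Proof.
move=> fb x y.
have step (s : seq 'I_n) (d : 'I_n -> R) (u : 'rV[R]_n) :
    normc (f (u + \sum_(i <- s) d i *: delta_mx 0 i) - f u) <=
    \sum_(i <- s) b (d i).
  elim: s u => [|i s ih] u; first by rewrite !big_nil addr0 subrr normc0.
  rewrite !big_cons addrA -(subrK (f (u + d i *: delta_mx 0 i)) (f (_ + _ + _))).
  rewrite -addrA addrC (le_trans (le_normcD _ _))// lerD//.
have E : x + \sum_i (y 0 i - x 0 i) *: delta_mx 0 i = y.
  rewrite -[RHS](subrK x) addrC; congr (_ + _).
  by rewrite [RHS]row_sum_delta; apply: eq_bigr => i _; rewrite !mxE.
by have := step (index_enum _) (fun i => y 0 i - x 0 i) x; rewrite E.
Qed.

Definition coord_lipschitz (L : R) f : Prop :=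
  forall x i t, normc (f (x + t *: delta_mx 0 i) - f x) <= L * `|t|.

Let floor_rV (N : nat) x : Zn n := \row_i Num.floor (N.+1%:R * x 0 i).

Let measurable_floor_rV N : measurable_fun setT (floor_rV N).
Proof.
move=> _ A _; rewrite setTI.
have -> : floor_rV N @^-1` A =
    \bigcup_k (if k \in A then floor_rV N @^-1` [set k] else set0).
  apply/seteqP; split => [x Ax|x [k _]].
    by exists (floor_rV N x) => //=; rewrite mem_set.
  by case: ifPn => // /set_mem Ak /= ->.
apply: countable_bigcupT_measurable; first exact: countableP.
move=> k; case: ifPn => // _.
have -> : floor_rV N @^-1` [set k] = \bigcap_(i in [set: 'I_n])
    ((fun x : 'rV[R]_n => N.+1%:R * x 0 i) @^-1`
       `[(k 0 i)%:~R, (k 0 i + 1)%:~R[%classic).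
  apply/seteqP; split => [x /= <- i _ /=|x xk].
    by rewrite in_itv /= mxE floor_itv.
  apply/rowP => i; rewrite mxE; apply: floor_def.
  by have := xk i I; rewrite /= in_itv.
apply: fin_bigcap_measurable; first exact: finite_finset.
move=> i _; rewrite -[X in measurable X]setTI.
suff : measurable_fun setT (fun x : 'rV[R]_n => N.+1%:R * x 0 i) by apply.
by apply: measurable_funM => //; exact: measurable_coor.
Qed.

(** Such a function is the uniform limit of its samples on finer and finer
    grids, and each of these samplings factors through a countable set. *)
Lemma cmeasurable_coord_lipschitz (L : R) f :
  coord_lipschitz L f -> cmeasurable f.
Proof.
move=> fL.
have L0 (i : 'I_n) : 0 <= L.
  by have := fL 0 i 1; rewrite normr1 mulr1; apply: le_trans; exact: normc_ge0.
pose grid (N : nat) (k : Zn n) : 'rV[R]_n := N.+1%:R^-1 *: Zn_to_rV R k.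
have approx N x : normc (f x - f (grid N (floor_rV N x))) <= L * n%:R / N.+1%:R.
  apply: le_trans (normc_sub_le_coord fL _ _) _.
  have -> : L * n%:R / N.+1%:R = \sum_(i < n) L / N.+1%:R.
    by rewrite sumr_const card_ord -[RHS]mulr_natr mulrAC.
  apply: ler_sum => i _; apply: ler_wpM2l; first exact: L0 i.
  rewrite !mxE; set t := x 0 i.
  have N0 : 0 < N.+1%:R :> R by rewrite ltr0n.
  rewrite -(ler_pM2l N0) divff ?gt_eqF// -[X in X * `|_|]gtr0_norm// -normrM.
  rewrite mulrBr mulrA divff ?gt_eqF// mul1r.
  have /andP[h1 h2] := floor_itv (N.+1%:R * t); rewrite intrD in h2.
  by rewrite ger0_norm ?subr_ge0// lerBlDl ltW.
have lim (h : R[i] -> R) : (forall z1 z2, h (z1 - z2) = h z1 - h z2) ->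
    (forall z, `|h z| <= normc z) ->
    measurable_fun setT (fun x => h (f x)).
  move=> hB hle.
  apply: (@measurable_fun_cvg _ _ _ _
    (fun N x => h (f (grid N (floor_rV N x))))) => [N|x _].
    by apply: (measurableT_comp (f := fun k : Zn n => h (f (grid N k)))).
  apply/cvgrPdist_le => /= e e0; near=> N.
  rewrite -hB (le_trans (hle _))// (le_trans (approx _ _))//.
  rewrite ler_pdivrMr ?ltr0n// -ler_pdivrMl// mulrC.
  apply: (@le_trans _ _ N%:R); last by rewrite ler_nat.
  by near: N; exact: nbhs_infty_ger.
split; apply: lim => *.
- by rewrite ReD ReN.
- exact: normc_Re_le.
- by rewrite ImD ImN.
- exact: normc_Im_le.
Unshelve. all: by end_near. Qed.

End coordinate_moduli.

Section fejer_kernel.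
Variables (R : realType) (n : nat).
Implicit Types (f : 'rV[R]_n -> R[i]) (x y w : 'rV[R]_n) (k : Zn n).
Local Notation C := R[i].

Section box.
Variable N : nat.
Let box : finType := {ffun 'I_n -> 'I_N.+1}.

Definition box_freq (q : box) : Zn n := \row_i (q i : int).

Lemma box_freq_inj : injective box_freq.
Proof.
move=> q q' /rowP qq'; apply/ffunP => i; apply/val_inj.
by have := qq' i; rewrite !mxE => -[].
Qed.

Definition box_poly (c : box -> R) w : C :=
  \sum_q (c q)%:C * echar (box_freq q) w.

Lemma cintegrable_box_poly c : cintegrable (haar R n) (box_poly c).
Proof.
apply: cintegrable_sum => q; apply: cintegrableZ; exact: cintegrable_echar.
Qed.

Lemma box_poly_sqrE c w : ((normc (box_poly c w) ^+ 2)%:C =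
  \sum_q \sum_q' (c q * c q')%:C * echar (box_freq q - box_freq q') w)%R.
Proof.
rewrite -mulc_conj /box_poly conjc_sum big_distrlr.
apply: eq_bigr => q _; apply: eq_bigr => q' _.
by rewrite echarDr echarNr conjcM conjc_realc real_complexM mulrACA.
Qed.

Lemma measurable_box_poly_sqr c :
  measurable_fun setT (fun w => normc (box_poly c w) ^+ 2).
Proof.
apply: measurable_funX; apply: measurable_normc.
exact: cintegrable_cmeasurable (cintegrable_box_poly c).
Qed.

Lemma box_poly_sqr_bound c w :
  normc (box_poly c w) ^+ 2 <= \sum_q \sum_q' `|c q * c q'|.
Proof.
have sum_le (I : finType) (z : I -> C) : normc (\sum_i z i) <= \sum_i normc (z i).
  elim/big_ind2 : _ => [|a1 b1 a2 b2 h1 h2|//]; first by rewrite normc0.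
  by rewrite (le_trans (le_normcD _ _))// lerD.
rewrite -[leLHS]ger0_norm ?sqr_ge0// -normc_real box_poly_sqrE.
rewrite (le_trans (sum_le _ _))// ler_sum// => q _.
rewrite (le_trans (sum_le _ _))// ler_sum// => q' _.
by rewrite normcM normc_real normc_echar mulr1.
Qed.

(** Parseval's identity for trigonometric polynomials. *)
Lemma integral_box_poly_sqr c :
  (\int[haar R n]_w (normc (box_poly c w) ^+ 2)%:E = (\sum_q c q ^+ 2)%:E)%E.
Proof.
have iP : (haar R n).-integrable setT
    (fun w => (normc (box_poly c w) ^+ 2)%:E).
  apply: (@le_integrable _ _ _ _ _ _ _
    (fun=> (\sum_q \sum_q' `|c q * c q'|)%:E)) => //.
  - by apply/measurable_EFinP; exact: measurable_box_poly_sqr.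
  - move=> w _; rewrite lee_fin ger0_norm ?sqr_ge0//.
    by rewrite (le_trans (box_poly_sqr_bound _ _))// ler_norm.
  - exact: finite_measure_integrable_cst.
rewrite -(fineK (integrable_fin_num _ iP))//; congr EFin.
transitivity (complex.Re (cintegral (haar R n)
    (fun w => (normc (box_poly c w) ^+ 2)%:C))); first by [].
under eq_cintegral do rewrite box_poly_sqrE.
rewrite cintegral_sum; last first.
  move=> q; apply: cintegrable_sum => q'.
  by apply: cintegrableZ; exact: cintegrable_echar.
rewrite (_ : \sum_q _ = (\sum_q c q ^+ 2)%:C)//.
rewrite rmorph_sum; apply: eq_bigr => q _.
rewrite cintegral_sum; last first.
  by move=> q'; apply: cintegrableZ; exact: cintegrable_echar.
rewrite (bigD1 q)//= cintegralZ; last exact: cintegrable_echar.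
rewrite cintegral_echar subrr eqxx mulr1 big1 ?addr0 -?expr2//.
move=> q' q'q; rewrite cintegralZ; last exact: cintegrable_echar.
rewrite cintegral_echar subr_eq0 (inj_eq box_freq_inj) eq_sym (negbTE q'q).
by rewrite mulr0.
Qed.

Lemma box_poly_prod (d : 'I_n -> 'I_N.+1 -> R) w :
  box_poly (fun q => \prod_j d j (q j)) w =
  \prod_j \sum_a (d j a)%:C * cis2pi (w 0 j) ^+ a.
Proof.
rewrite bigA_distr_bigA /=; apply: eq_bigr => q _.
rewrite big_split /= rmorph_prod; congr (_ * _).
rewrite /echar /dot (@big_morph _ _ _ _ _ _ _ (@cis2piD R) (@cis2pi0 R)).
apply: eq_bigr => j _; rewrite !mxE.
elim: (q j : nat) => [|m ih]; first by rewrite mulr0 cis2pi0 expr0.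
by rewrite exprS -ih -cis2piD intS intrD mulrDr mulr1.
Qed.

(** The Fejer kernel of the torus, up to the factor [N.+1 ^ n]. *)
Definition fejer w : R := normc (box_poly (fun=> 1) w) ^+ 2.

(** The analogous kernel for the face of the box where the [i]-th frequency
    is 0. *)
Definition fejer_face (i : 'I_n) w : R :=
  normc (box_poly (fun q => (q i == ord0)%:R) w) ^+ 2.

(** The trigonometric polynomial of the box is a product of geometric sums, and
    multiplication by [cis2pi (w 0 i) - 1] telescopes the [i]-th one. *)
Lemma fejer_faceP i w :
  normc (cis2pi (w 0 i) - 1) ^+ 2 * fejer w <= 4 * fejer_face i w.
Proof.
have E : (cis2pi (w 0 i) - 1) * box_poly (fun=> 1) w =
    (cis2pi (w 0 i) ^+ N.+1 - 1) * box_poly (fun q => (q i == ord0)%:R) w.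
  have -> : box_poly (fun=> 1) w = box_poly (fun q => \prod_(j < n) 1) w.
    by apply: eq_bigr => q _; rewrite big1.
  pose d (j : 'I_n) (a : 'I_N.+1) : R := if j == i then (a == ord0)%:R else 1.
  have -> : box_poly (fun q => (q i == ord0)%:R) w =
      box_poly (fun q => \prod_j d j (q j)) w.
    apply: eq_bigr => q _; congr (_%:C * _); rewrite /d.
    by rewrite (bigD1 i)//= eqxx big1 ?mulr1// => j /negbTE ->.
  rewrite (box_poly_prod (fun _ _ => 1)) (box_poly_prod d) /d.
  rewrite (bigD1 i)//= [in RHS](bigD1 i)//= eqxx !mulrA; congr (_ * _).
    rewrite subrX1 -mulrA; congr (_ * _).
    have -> : \sum_(a < N.+1) ((a == ord0)%:R : R)%:C * cis2pi (w 0 i) ^+ a = 1.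
      rewrite (bigD1 ord0)//= expr0 mulr1 big1 ?addr0// => a /negbTE ->.
      by rewrite mul0r.
    by rewrite mulr1; apply: eq_bigr => a _; rewrite mul1r.
  by apply: eq_bigr => j /negbTE ->.
rewrite /fejer /fejer_face -exprMn -normcM E normcM exprMn.
rewrite ler_wpM2r ?sqr_ge0// (_ : 4 = 2 ^+ 2); last by ring.
rewrite ler_pXn2r ?nnegrE ?normc_ge0// (le_trans (le_normcD _ _))//.
have nX m : normc (cis2pi (w 0 i) ^+ m) = 1.
  by elim: m => [|m ih]; rewrite ?expr0 ?normc1// exprS normcM ih normc_cis2pi mulr1.
by rewrite normcN normc1 nX.
Qed.

(** By [fejer_faceP] and [integral_box_poly_sqr], the second moments of the
    normalized Fejer kernel are therefore of order [N.+1^-1]. *)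
Lemma fejer_mass_face (i : 'I_n) :
  N.+1%:R * \sum_(q : box) ((q i == ord0)%:R : R) ^+ 2 =
  \sum_(q : box) (1 : R) ^+ 2.
Proof.
have -> : \sum_(q : box) ((q i == ord0)%:R : R) ^+ 2 =
    \prod_(j < n) (if j == i then 1 else N.+1%:R).
  transitivity (\sum_(q : box) \prod_j
      (if j == i then (q j == ord0)%:R else 1 : R)).
    apply: eq_bigr => q _; rewrite (bigD1 i)//= eqxx big1 ?mulr1.
      by case: (_ == _); rewrite ?expr1n ?expr0n.
    by move=> j /negbTE ->.
  rewrite -(bigA_distr_bigA (fun j a => if j == i then (a == ord0)%:R else 1)).
  apply: eq_bigr => j _; case: ifP => _.
    by rewrite (bigD1 ord0)//= big1 ?addr0// => a /negbTE ->.
  by rewrite sumr_const card_ord.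
rewrite (bigD1 i)//= eqxx mul1r.
rewrite (eq_bigr (fun=> N.+1%:R)); last by move=> j /negbTE ->.
transitivity (\prod_(j < n) (N.+1%:R : R)); first by rewrite [RHS](bigD1 i).
under [RHS]eq_bigr do rewrite expr1n.
by rewrite prodr_const sumr_const card_ord card_ffun !card_ord natrX.
Qed.

Lemma fejer_mass_gt0 : 0 < \sum_(q : box) (1 : R) ^+ 2.
Proof.
under eq_bigr do rewrite expr1n.
by rewrite sumr_const card_ffun card_ord natrX exprn_gt0.
Qed.

End box.

Lemma normc_cis2pi_sub1_sqr (t : R) :
  normc (cis2pi t - 1) ^+ 2 = 2 - 2 * cos (2 * pi * t).
Proof.
rewrite normc_sqr ReD ImD ReN ImN /= oppr0 addr0.
by have := cos2Dsin2 (2 * pi * t); lra.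
Qed.

Section uniqueness.
Variables (f : 'rV[R]_n -> C) (L B : R).
Hypothesis f_lip : coord_lipschitz L f.
Hypothesis f_per : forall x k, f (x + Zn_to_rV R k) = f x.
Hypothesis f_bnd : forall x, normc (f x) <= B.

(** Small increments are controlled by the Lipschitz constant, the other ones
    by the sup norm, since [normc (cis2pi t - 1)] is then bounded below. *)
Lemma periodic_modulus (eps : R) : 0 < eps -> exists2 K : R, 0 <= K &
  forall x i t, normc (f (x + t *: delta_mx 0 i) - f x) <=
    eps + K * normc (cis2pi t - 1) ^+ 2.
Proof.
move=> eps0.
have B0 : 0 <= B by rewrite (le_trans (normc_ge0 (f 0))).
(* [del < 1 / 2] keeps [2 * pi * del] in the interval where [cos] decreases. *)
pose del : R := Num.min (4^-1) (eps / (`|L| + 1)).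
have L1 : 0 < `|L| + 1 by rewrite ltr_wpDl.
have del0 : 0 < del by rewrite lt_min invr_gt0 ltr0n divr_gt0.
have del4 : del <= 4^-1 by rewrite ge_min lexx.
have Ldel : `|L| * del <= eps.
  apply: (@le_trans _ _ ((`|L| + 1) * (eps / (`|L| + 1)))); last first.
    by rewrite mulrCA divff ?mulr1// gt_eqF.
  by apply: ler_pM => //; [exact: ltW|rewrite lerDl|rewrite ge_min lexx orbT].
have pi0 := pi_gt0 R.
have in0pi (s : R) : 0 <= s -> s <= 2^-1 -> 2 * pi * s \in `[0, pi].
  by move=> s0 s2; rewrite in_itv /=; apply/andP; split; nra.
have cosdel : cos (2 * pi * del) < 1.
  have del_in : 2 * pi * del \in `[0, pi] by apply: in0pi; lra.
  have zero_in : 0 \in `[0, pi : R] by rewrite in_itv /= lexx pi_ge0.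
  by rewrite -[X in _ < X]cos0 ltr_cos// !mulr_gt0.
pose K : R := 2 * B / (2 - 2 * cos (2 * pi * del)).
have K0 : 0 <= K by rewrite divr_ge0 ?mulr_ge0//; lra.
exists K => // x i t.
(* [s] is the representative of [t] modulo 1 in the interval [-1/2, 1/2[. *)
pose z : int := Num.floor (t + 2^-1); pose s : R := t - z%:~R.
have tE : t = s + z%:~R by rewrite /s subrK.
have s2 : `|s| <= 2^-1.
  have := floor_itv (t + 2^-1); rewrite -/z intrD /s ler_norml => /andP[? ?].
  by apply/andP; split; lra.
have fE : f (x + t *: delta_mx 0 i) = f (x + s *: delta_mx 0 i).
  rewrite -[RHS](f_per _ (\row_j (if j == i then z else 0))) tE scalerDl addrA.
  congr (f (_ + _)); apply/rowP => j; rewrite !mxE eqxx /=.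
  by case: eqP; rewrite ?mulr1// mulr0.
have eE : cis2pi t = cis2pi s :> C by rewrite tE cis2piD cis2pi_int mulr1.
rewrite fE eE.
have [sdel|dels] := leP `|s| del.
  rewrite (le_trans (f_lip _ _ _))// (@le_trans _ _ eps)//; last first.
    by rewrite lerDl mulr_ge0// sqr_ge0.
  apply: le_trans Ldel; rewrite (le_trans (ler_wpM2r _ (ler_norm L)))//.
  exact: ler_wpM2l.
apply: (@le_trans _ _ (2 * B)).
  rewrite (le_trans (le_normcD _ _))// normcN mulr_natl mulr2n lerD//.
rewrite -[leLHS]add0r lerD ?(ltW eps0)// normc_cis2pi_sub1_sqr.
have -> : cos (2 * pi * s) = cos (2 * pi * `|s|).
  by case: ger0P => // _; rewrite mulrN cosN.
rewrite /K -[leRHS]mulrA -[leLHS]mulr1 ler_wpM2l ?mulr_ge0//.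
rewrite ler_pdivlMl ?mulr1; last by lra.
rewrite lerD2l lerN2 ler_wpM2l// ltW//.
have del_in : 2 * pi * del \in `[0, pi] by apply: in0pi; lra.
have s_in : 2 * pi * `|s| \in `[0, pi] by exact: in0pi.
by rewrite ltr_cos// ltr_pM2l// mulr_gt0.
Qed.

Let cmeasurable_f : cmeasurable f.
Proof. exact: cmeasurable_coord_lipschitz f_lip. Qed.

Let cintegrable_f_echar k : cintegrable (haar R n) (fun x => f x * echar k x).
Proof.
apply: (@cintegrable_haar_bounded _ _ _ B).
  by apply: cmeasurableM => //; exact: cmeasurable_echar.
by move=> x; rewrite normcM normc_echar mulr1.
Qed.

Let cintegrable_fejer N : cintegrable (haar R n) (fun x => (fejer N x)%:C).
Proof.
apply: (@cintegrable_haar_bounded _ _ _ (\sum_(q : {ffun 'I_n -> 'I_N.+1})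
    \sum_(q' : {ffun 'I_n -> 'I_N.+1}) `|1 * 1 : R|)).
  split => /=; last exact: measurable_cst.
  exact: measurable_box_poly_sqr.
move=> x; rewrite normc_real ger0_norm ?sqr_ge0//.
exact: box_poly_sqr_bound.
Qed.

Let cintegrable_f_fejer N :
  cintegrable (haar R n) (fun x => f x * (fejer N x)%:C).
Proof.
apply: (@cintegrable_normc_le _ _ _ _ _ (fun x => B%:C * (fejer N x)%:C)).
- by apply: cmeasurableM => //; exact: cintegrable_cmeasurable (cintegrable_fejer N).
- exact/cintegrableZ/cintegrable_fejer.
- move=> x; rewrite !normcM ler_wpM2r ?normc_ge0// normc_real.
  by rewrite (le_trans (f_bnd x))// ler_norm.
Qed.

(** The integral of [f] against the Fejer kernel vanishes; it also approximates
    [f 0], because the kernel concentrates at the origin. *)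
Lemma fourier_unique0 :
  (forall k, cintegral (haar R n) (fun x => f x * echar k x) = 0) -> f 0 = 0.
Proof.
move=> f0k; apply/eqP; rewrite -normc_eq0; apply/eqP/le_anti.
rewrite normc_ge0 andbT leNgt; apply/negP; set a := normc (f 0) => a0.
(* [eps] and [N] make each of the two terms of the upper bound at most
   [a / 4 * M], where [M] is the mass of the kernel. *)
pose eps : R := a / (4 * n.+1%:R).
have eps0 : 0 < eps by rewrite divr_gt0// mulr_gt0// ltr0n.
have [K K0 fK] := periodic_modulus eps0.
pose N := Num.truncn (16 * n%:R * K / a).
pose M : R := \sum_(q : {ffun 'I_n -> 'I_N.+1}) 1 ^+ 2.
pose S (i : 'I_n) : R := \sum_(q : {ffun 'I_n -> 'I_N.+1}) (q i == ord0)%:R ^+ 2.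
have M0 : 0 < M by exact: fejer_mass_gt0.
have fejer0 : cintegral (haar R n) (fun x => f x * (fejer N x)%:C) = 0.
  under eq_cintegral => x.
    rewrite box_poly_sqrE mulr_sumr.
    under eq_bigr => q _.
      rewrite mulr_sumr; under eq_bigr => q' _ do rewrite mulrCA.
      over.
    over.
  rewrite cintegral_sum => [|q]; last first.
    by apply: cintegrable_sum => q'; exact: cintegrableZ.
  rewrite big1// => q _; rewrite cintegral_sum => [|q']; last first.
    exact: cintegrableZ.
  by rewrite big1// => q' _; rewrite cintegralZ// f0k mulr0.
have fejerM : cintegral (haar R n) (fun x => (fejer N x)%:C) = M%:C.
  apply: complex_ext => /=; last by rewrite /Rintegral integral0.
  by rewrite /Rintegral integral_box_poly_sqr.
have E : cintegral (haar R n) (fun x => (f 0 - f x) * (fejer N x)%:C) =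
    f 0 * M%:C.
  under eq_cintegral => x.
    rewrite mulrBl -[X in _ - X]mul1r -mulNr.
    over.
  rewrite cintegralD; [|exact: cintegrableZ..].
  by rewrite !cintegralZ// fejerM fejer0 mulr0 addr0.
have upper : (\int[haar R n]_x (normc ((f 0 - f x) * (fejer N x)%:C))%:E <=
    (\sum_i (eps * M + 4 * K * S i))%:E)%E.
  pose b i x : \bar R := ((eps * fejer N x)%:E + (4 * K * fejer_face N i x)%:E)%E.
  have F0 x : 0 <= fejer N x by exact: sqr_ge0.
  have Fi0 i x : 0 <= fejer_face N i x by exact: sqr_ge0.
  have mF : measurable_fun setT (fejer N) by exact: measurable_box_poly_sqr.
  have mFi i : measurable_fun setT (fejer_face N i).
    exact: measurable_box_poly_sqr.
  have mb1 : measurable_fun setT (fun x => (eps * fejer N x)%:E).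
    by apply/measurable_EFinP; exact: measurable_funM.
  have mb2 i : measurable_fun setT (fun x => (4 * K * fejer_face N i x)%:E).
    by apply/measurable_EFinP; exact: measurable_funM.
  have mb i : measurable_fun setT (b i) by exact: emeasurable_funD.
  have b10 x : (0 <= (eps * fejer N x)%:E)%E.
    by rewrite lee_fin mulr_ge0// ltW.
  have b20 i x : (0 <= (4 * K * fejer_face N i x)%:E)%E.
    by rewrite lee_fin mulr_ge0// mulr_ge0.
  have b0 i x : (0 <= b i x)%E by exact: adde_ge0.
  apply: (@le_trans _ _ (\int[haar R n]_x \sum_i b i x)%E); last first.
    rewrite ge0_integral_sum// -sumEFin; apply: lee_sum => i _.
    rewrite ge0_integralD//; under eq_integral do rewrite EFinM.
    rewrite ge0_integralZl//; last 3 first.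
    - exact/measurable_EFinP.
    - by move=> x _; rewrite lee_fin sqr_ge0.
    - by rewrite lee_fin ltW.
    under [X in (_ + X)%E]eq_integral do rewrite EFinM.
    rewrite ge0_integralZl//; last 3 first.
    - exact/measurable_EFinP.
    - by move=> x _; rewrite lee_fin sqr_ge0.
    - by rewrite lee_fin mulr_ge0.
    by rewrite !integral_box_poly_sqr -!EFinM -EFinD.
  apply: ge0_le_integral => //.
  - by move=> x _; rewrite lee_fin normc_ge0.
  - apply: measurable_normcE; apply: cmeasurableM.
      apply: cmeasurableD; first exact: cmeasurable_cst.
      under eq_fun do rewrite -mulN1r.
      by apply: cmeasurableM => //; exact: cmeasurable_cst.
    exact: cintegrable_cmeasurable (cintegrable_fejer N).
  - by apply: emeasurable_sum => i; exact: mb.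
  move=> x _; rewrite sumEFin lee_fin normcM normc_real (ger0_norm (sqr_ge0 _)).
  rewrite -opprB normcN.
  apply: (@le_trans _ _ (\sum_i (eps + K * normc (cis2pi (x 0 i) - 1) ^+ 2) *
      fejer N x)).
    rewrite -mulr_suml ler_wpM2r ?sqr_ge0//.
    by have := normc_sub_le_coord fK 0 x; under eq_bigr do rewrite mxE subr0.
  apply: ler_sum => i _; rewrite mulrDl lerD2l -mulrA.
  by rewrite [4 * K]mulrC -[leRHS]mulrA ler_wpM2l// fejer_faceP.
have : a * M <= \sum_i (eps * M + 4 * K * S i).
  rewrite -lee_fin; apply: le_trans upper.
  have -> : a * M = normc (f 0 * M%:C) by rewrite normcM normc_real gtr0_norm.
  rewrite -E; apply: normc_cintegral_le; apply: cmeasurableM.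
    apply: cmeasurableD; first exact: cmeasurable_cst.
    under eq_fun do rewrite -mulN1r.
    by apply: cmeasurableM => //; exact: cmeasurable_cst.
  exact: cintegrable_cmeasurable (cintegrable_fejer N).
have SE i : S i = M / N.+1%:R.
  by rewrite /M -(fejer_mass_face N i) mulrAC divff ?mul1r// pnatr_eq0.
under eq_bigr do rewrite SE.
rewrite sumr_const card_ord -[leRHS]mulr_natl; apply/negP; rewrite -ltNge.
have n1 : 0 < n.+1%:R :> R by rewrite ltr0n.
have N1 : 0 < N.+1%:R :> R by rewrite ltr0n.
have e4 : n%:R * eps <= a / 4.
  have -> : n%:R * eps = a / 4 * (n%:R / n.+1%:R) by rewrite /eps invfM; ring.
  rewrite -[leRHS]mulr1 ler_wpM2l//.
    by rewrite divr_ge0// ltW.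
  by rewrite ler_pdivrMr// mul1r ler_nat.
have K4 : n%:R * (4 * K / N.+1%:R) <= a / 4.
  have := truncnS_gt (16 * n%:R * K / a); rewrite -/N ltr_pdivrMr// => NK.
  rewrite mulrA ler_pdivrMr//; lra.
have -> : n%:R * (eps * M + 4 * K * (M / N.+1%:R)) =
  (n%:R * eps + n%:R * (4 * K / N.+1%:R)) * M by ring.
by rewrite ltr_pM2r// (le_lt_trans (lerD e4 K4))//; lra.
Qed.

End uniqueness.

(** Translation reduces to the value at the origin. *)
Theorem fourier_unique f (L B : R) : coord_lipschitz L f ->
  (forall x k, f (x + Zn_to_rV R k) = f x) -> (forall x, normc (f x) <= B) ->
  (forall k, cintegral (haar R n) (fun x => f x * echar k x) = 0) ->
  forall x, f x = 0.
Proof.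
move=> fL fper fB f0k x0; pose h x := f (x + x0).
have -> : f x0 = h 0 by rewrite /h add0r.
have mf := cmeasurable_coord_lipschitz fL.
apply: (@fourier_unique0 h L B).
- by move=> x i t; rewrite /h addrAC; exact: fL.
- by move=> x k; rewrite /h addrAC fper.
- by move=> x; exact: fB.
move=> k.
have := @cintegral_haar_shift _ _ x0 (fun x => f x * echar k x).
rewrite f0k => H.
have : cintegral (haar R n) (fun x => echar k x0 * (h x * echar k x)) = 0.
  rewrite -H; last 2 first.
  - by apply: cmeasurableM => //; exact: cmeasurable_echar.
  - by move=> x l; rewrite fper echar_periodic.
  by apply: eq_cintegral => x; rewrite echarDl /h; ring.
rewrite cintegralZ.
  move=> /eqP; rewrite mulf_eq0 -normc_eq0 normc_echar oner_eq0 /=.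
  by move=> /eqP.
apply: (@cintegrable_haar_bounded _ _ _ B).
  apply: cmeasurableM; last exact: cmeasurable_echar.
  exact: (cmeasurable_comp mf (measurable_rV_shift x0)).
by move=> x; rewrite normcM normc_echar mulr1 fB.
Qed.
End fejer_kernel.

(** * Sums over the integer lattice *)

Section lattice_sums.
Variables (R : realType) (n : nat).
Implicit Types (k m : Zn n).
Local Open Scope ereal_scope.
Local Notation mu := (@counting (Zn n) R).

Lemma counting_set1 k : mu [set k] = 1.
Proof. by rewrite /counting asboolT// fset_set1 finmap.cardfs1. Qed.

Lemma integral_counting_set1 k (f : Zn n -> \bar R) :
  \int[mu]_(x in [set k]) f x = f k.
Proof.
rewrite (eq_integral (cst (f k))); last by move=> x; rewrite inE => ->.
by rewrite integral_cst//= counting_set1 mule1.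
Qed.

(** Split the lattice into the level sets of its enumeration by natural
    numbers, each of which has at most one point. *)
Lemma integral_countingE (f : Zn n -> \bar R) : (forall k, 0 <= f k) ->
  \int[mu]_k f k = \esum_(k in [set: Zn n]) f k.
Proof.
move=> f0; pose F (i : nat) := [set k : Zn n | pickle k = i].
have FE : [set: Zn n] = \bigcup_i F i.
  by apply/seteqP; split => // k _; exists (pickle k).
have tF : trivIset setT F.
  apply/trivIsetP => i j _ _ /eqP ij; apply/seteqP; split => // k [/= ki kj].
  by case: ij; rewrite -ki -kj.
rewrite FE ge0_integral_bigcup// nneseries_sum_bigcup//.
apply: eq_eseriesr => i _.
have [[k Fk]|F0] := pselect (exists k, F i k).
  have -> : F i = [set k].
    apply/seteqP; split => [x Fx|_ ->//].
    by apply: (pcan_inj (@pickleK (Zn n))); rewrite Fx Fk.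
  by rewrite integral_counting_set1 esum_set1.
have -> : F i = set0 by apply/seteqP; split => // k Fk; apply: F0; exists k.
by rewrite integral_set0 esum_set0.
Qed.

Lemma ge0_integral_counting_ge (f : Zn n -> \bar R) k :
  (forall k, 0 <= f k) -> f k <= \int[mu]_x f x.
Proof.
move=> f0; rewrite -[leLHS](integral_counting_set1 k f).
exact: ge0_subset_integral.
Qed.

Lemma integral_counting_reindex (e : Zn n -> Zn n) (f : Zn n -> \bar R) :
  bijective e -> (forall k, 0 <= f k) -> \int[mu]_k f (e k) = \int[mu]_k f k.
Proof.
move=> bij_e f0; rewrite !integral_countingE//.
by apply/esym/reindex_esum; rewrite setTT_bijective.
Qed.

Lemma integral_counting_shift m (f : Zn n -> \bar R) :
  (forall k, 0 <= f k) -> \int[mu]_k f (k - m)%R = \int[mu]_k f k.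
Proof.
apply: (integral_counting_reindex (e := fun k => (k - m)%R)).
by exists (fun k => (k + m)%R) => k; rewrite ?subrK ?addrK.
Qed.

Lemma integral_counting_reflect m (f : Zn n -> \bar R) :
  (forall k, 0 <= f k) -> \int[mu]_k f (m - k)%R = \int[mu]_k f k.
Proof.
apply: (integral_counting_reindex (e := fun k => (m - k)%R)).
by exists (fun k => (m - k)%R) => k; rewrite opprB addrC subrK.
Qed.

Lemma csummableP (u : Zn n -> R[i]) :
  csummable u <-> \int[mu]_k (normc (u k))%:E < +oo.
Proof.
by split=> [/cintegrableP[]//|uoo]; apply/cintegrableP.
Qed.

End lattice_sums.

Section lattice_summability.
Variables (R : realType) (n : nat).
Local Notation mu := (@counting (Zn n) R).

Lemma sum_inv_sqr_le2 (N : nat) :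
  \sum_(m < N) (m.+1%:R ^+ 2)^-1 <= 2 :> R.
Proof.
case: N => [|N]; first by rewrite big_ord0.
(* Telescoping comparison with the sums of [m^-1 - (m + 1)^-1]. *)
suff : \sum_(m < N.+1) (m.+1%:R ^+ 2)^-1 <= 2 - N.+1%:R^-1 :> R.
  by move=> /le_trans; apply; rewrite gerBl.
elim: N => [|N ih]; first by rewrite big_ord1 expr1n invr1; lra.
rewrite big_ord_recr /= (le_trans (lerD ih (lexx _)))//.
have N1 : 0 < N.+1%:R :> R by rewrite ltr0n.
have -> : N.+2%:R = N.+1%:R + 1 :> R by rewrite natr1.
set x : R := N.+1%:R in N1 *.
have : ((x + 1) ^+ 2)^-1 <= x^-1 - (x + 1)^-1.
  have -> : x^-1 - (x + 1)^-1 = (x * (x + 1))^-1.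
    by field; rewrite !gt_eqF//; lra.
  rewrite lef_pV2 ?posrE ?exprn_gt0 ?mulr_gt0//; nra.
by move=> h; rewrite (le_trans (lerD (lexx _) h))// addrA subrK.
Qed.

Lemma Znorm_ge0 (k : Zn n) : 0 <= Znorm R k.
Proof. by apply: sumr_ge0. Qed.

(** The inverse of the weight is at most the product over the coordinates of
    [(1 + |k_i|)^-2], whose sum over a box factors. *)
Lemma integral_weight_le :
  (\int[mu]_k (((1 + Znorm R k) ^+ (2 * n))^-1)%:E <= (4 ^+ n)%:E)%E.
Proof.
rewrite integral_countingE => [|k]; last first.
  by rewrite lee_fin invr_ge0 exprn_ge0// addr_ge0// Znorm_ge0.
apply: ge_ereal_sup => _ [X [finX _] <-].
rewrite fsbig_finite//= sumEFin lee_fin.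
move: (finmap.enum_fset _) (finmap.fset_uniq (fset_set X)) => s uniq_s.
pose N := (\max_(k <- s) \max_(i < n) absz (k 0%R i)).+1.
(* Signs and absolute values parametrize a box that contains the given finite
   set; points with a zero coordinate are reached several times. *)
pose Q : finType := {ffun 'I_n -> bool * 'I_N}.
pose point (q : Q) : Zn n := \row_i ((-1) ^+ (q i).1 * ((q i).2 : nat)%:Z).
pose index (k : Zn n) : Q :=
  [ffun i => (k 0 i < 0, inord (absz (k 0 i)))].
have indexK k : k \in s -> point (index k) = k.
  move=> kX; apply/rowP => i; rewrite mxE ffunE /= inordK -?intEsign//.
  rewrite ltnS (leq_trans _ (leq_bigmax_seq _ kX isT))//.
  exact: (leq_bigmax (F := fun i => absz (k 0 i))).
pose w (k : Zn n) : R := ((1 + Znorm R k) ^+ (2 * n))^-1.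
have w0 k : 0 <= w k by rewrite invr_ge0 exprn_ge0// addr_ge0// Znorm_ge0.
apply: (@le_trans _ _ (\sum_q w (point q))).
  have -> : \sum_(k <- s) w k =
      \sum_(q <- [seq index k | k <- s]) w (point q).
    rewrite big_map big_seq [RHS]big_seq.
    by apply: eq_bigr => k kX; rewrite indexK.
  rewrite big_uniq /=; last first.
    rewrite map_inj_in_uniq // => k k' kX k'X kk'.
    by rewrite -[k]indexK// kk' indexK.
  by rewrite [leRHS](bigID (mem [seq index k | k <- s])) /= lerDl sumr_ge0.
apply: (@le_trans _ _ (\sum_(q : Q) \prod_i (((q i).2).+1%:R ^+ 2)^-1)).
  apply: ler_sum => q _; rewrite prodfV /w lef_pV2 ?posrE; last 2 first.
  - by rewrite exprn_gt0// ltr_pwDl// Znorm_ge0.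
  - by rewrite prodr_gt0// => i _; rewrite exprn_gt0// ltr0n.
  rewrite exprM -[X in _ <= _ ^+ X]card_ord -prodr_const.
  apply: ler_prod => i _; rewrite exprn_ge0//= ler_pXn2r ?nnegrE//; last first.
    by rewrite addr_ge0// Znorm_ge0.
  rewrite -natr1 addrC lerD2l /Znorm (bigD1 i)//= !mxE intrM normrM.
  rewrite rmorphXn /= rmorphN1 normrX normrN1 expr1n mul1r.
  by rewrite ger0_norm ?ler0n// lerDl sumr_ge0.
rewrite -(bigA_distr_bigA (fun _ (p : bool * 'I_N) => (p.2.+1%:R ^+ 2)^-1)).
rewrite prodr_const card_ord.
rewrite -(pair_bigA _ (fun (_ : bool) (m : 'I_N) => (m.+1%:R ^+ 2)^-1 : R)) /=.
rewrite sumr_const card_bool lerXn2r ?nnegrE ?ler0n//.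
  by rewrite mulrn_wge0// sumr_ge0// => m _; rewrite invr_ge0 exprn_ge0.
by have := sum_inv_sqr_le2 N; rewrite mulr2n; lra.
Qed.

Lemma schwartzZ_summable (g : Zn n -> R[i]) : schwartzZ g ->
  (\int[mu]_k (normc (g k))%:E < +oo)%E.
Proof.
move=> /(_ (2 * n)%N)[B gB].
have B0 : 0 <= B.
  by rewrite (le_trans _ (gB 0))// mulr_ge0 ?normc_ge0// exprn_ge0// addr_ge0// Znorm_ge0.
apply: (@le_lt_trans _ _
    (\int[mu]_k (B%:E * (((1 + Znorm R k) ^+ (2 * n))^-1)%:E))%E).
  apply: ge0_le_integral => //.
    by move=> k _; rewrite lee_fin normc_ge0.
  move=> k _; rewrite -EFinM lee_fin ler_pdivlMr 1?mulrC ?gB//.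
  by rewrite exprn_gt0// ltr_pwDl// Znorm_ge0.
rewrite ge0_integralZl//; last first.
  by move=> k _; rewrite lee_fin invr_ge0 exprn_ge0// addr_ge0// Znorm_ge0.
apply: le_lt_trans (ltry (B * 4 ^+ n)); rewrite EFinM.
by apply: lee_wpmul2l; [rewrite lee_fin|exact: integral_weight_le].
Qed.

End lattice_summability.

(** * Modulation spaces on the integer lattice *)

Section complex_Lnorm.
Context d (T : measurableType d) (R : realType).
Implicit Types (mu : {measure set T -> \bar R}) (f : T -> R[i]) (p A : R).
Local Open Scope ereal_scope.

Lemma cLnorm1 mu f : cLnorm mu 1 f = \int[mu]_x (normc (f x))%:E.
Proof.
rewrite /cLnorm Lnorm1; apply: eq_integral => x _.
by rewrite gee0_abs// lee_fin normc_ge0.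
Qed.

Lemma cLnorm_powK mu f p : (0 < p)%R ->
  cLnorm mu p f = (\int[mu]_x (normc (f x) `^ p)%:E) `^ p^-1.
Proof.
move=> p0; have pN0 : (p != 0)%R by rewrite gt_eqF.
rewrite -[LHS]poweRe1; last exact: Lnorm_ge0.
rewrite -(mulfV pN0) poweRrM powR_Lnorm//; congr (_ `^ _).
apply: eq_integral => x _.
by rewrite -poweR_EFin gee0_abs// lee_fin normc_ge0.
Qed.

Lemma measurable_normc_powR f p : cmeasurable f ->
  measurable_fun setT (fun x => (normc (f x) `^ p)%:E).
Proof.
move=> mf; apply/measurable_EFinP.
by apply: (measurableT_comp (measurable_powR p)); exact: measurable_normc.
Qed.

(** Interpolation between the sup norm and the L^1 norm. *)
Lemma cLnorm_le_interp mu f p A : (1 <= p)%R -> cmeasurable f ->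
  (forall x, normc (f x) <= A)%R -> \int[mu]_x (normc (f x))%:E <= A%:E ->
  cLnorm mu p f <= A%:E.
Proof.
move=> p1 mf fA iA; have p0 : (0 < p)%R by rewrite (lt_le_trans _ p1).
have A0 : (0 <= A)%R.
  rewrite -lee_fin (le_trans _ iA)//; apply: integral_ge0 => x _.
  by rewrite lee_fin normc_ge0.
have p10 : (0 <= p - 1)%R by rewrite subr_ge0.
have fp : \int[mu]_x (normc (f x) `^ p)%:E <= (A `^ p)%:E.
  apply: (@le_trans _ _ (\int[mu]_x ((A `^ (p - 1))%:E * (normc (f x))%:E))).
    apply: ge0_le_integral => //.
    - by move=> x _; rewrite lee_fin powR_ge0.
    - exact: measurable_normc_powR.
    - by apply: measurable_funeM; exact: measurable_normcE.
    - move=> x _; rewrite -EFinM lee_fin -mulr_powRB1 ?normc_ge0// mulrC.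
      rewrite ler_wpM2r ?normc_ge0// ge0_ler_powR ?nnegrE ?normc_ge0//.
  rewrite ge0_integralZl ?lee_fin ?powR_ge0//; last 2 first.
  - exact: measurable_normcE.
  - by move=> x _; rewrite lee_fin normc_ge0.
  rewrite -(mulr_powRB1 A0 p0) EFinM [leRHS]muleC.
  by apply: lee_wpmul2l => //; rewrite lee_fin powR_ge0.
rewrite cLnorm_powK//.
have -> : A%:E = (A `^ p)%:E `^ p^-1.
  by rewrite poweR_EFin -powRrM mulfV ?gt_eqF// powRr1.
apply: gt0_ler_poweR => //.
- by rewrite invr_ge0 ltW.
- rewrite in_itv /= leey andbT; apply: integral_ge0 => x _.
  by rewrite lee_fin powR_ge0.
- by rewrite in_itv /= leey andbT lee_fin powR_ge0.
Qed.

(** Hoelder against the constant function. *)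
Lemma integral_normc_le_cLnorm (P : probability T R) f p : (1 <= p)%R ->
  cmeasurable f -> \int[P]_x (normc (f x))%:E <= cLnorm P p f.
Proof.
rewrite le_eqVlt => /predU1P[<- _|p1 mf]; first by rewrite cLnorm1.
have p0 : (0 < p)%R by rewrite (lt_trans _ p1).
have mn := measurable_normc mf.
pose q := (p / (p - 1))%R.
have p10 : (0 < p - 1)%R by rewrite subr_gt0.
have q0 : (0 < q)%R by rewrite divr_gt0.
have pq : (p^-1 + q^-1 = 1)%R by rewrite /q; field; rewrite !gt_eqF.
have m1 : measurable_fun [set: T] (cst (1%R : R)) by exact: measurable_cst.
have := hoelder P mn m1 p0 q0 pq.
have -> : 'N[P]_q%:E[EFin \o cst 1%R] = 1.
  rewrite Lnorm_cst1 -[RHS](poweR1r q^-1); congr (_ `^ _).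
  exact: probability_setT.
rewrite mule1; apply: le_trans; rewrite Lnorm1; apply: ge0_le_integral => //.
- by move=> x _; rewrite lee_fin normc_ge0.
- by apply/measurable_EFinP.
- apply: measurableT_comp => //; apply/measurable_EFinP.
  by apply: measurable_funM.
- by move=> x _; rewrite /= mulr1 lee_fin ler_norm.
Qed.

End complex_Lnorm.

Section stft_lattice.
Variables (R : realType) (n : nat).
Implicit Types (g f u : Zn n -> R[i]) (k m : Zn n) (w : 'rV[R]_n).
Local Notation mu := (@counting (Zn n) R).
Local Notation haar := (haar R n).

Lemma Znorm_triangle k m : Znorm R (k + m) <= Znorm R k + Znorm R m.
Proof.
rewrite /Znorm -big_split /=; apply: ler_sum => i _.
by rewrite !mxE intrD ler_normD.
Qed.

Lemma weight_shift_le k m (N : nat) :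
  (1 + Znorm R k) ^+ N <= (1 + Znorm R m) ^+ N * (1 + Znorm R (k - m)) ^+ N.
Proof.
have := Znorm_triangle (k - m) m; rewrite subrK => h.
have a0 := Znorm_ge0 R m; have b0 := Znorm_ge0 R (k - m).
have c0 := Znorm_ge0 R k.
rewrite -exprMn lerXn2r ?nnegrE ?mulr_ge0 ?addr_ge0//.
set a := Znorm R m in a0 h *; set b := Znorm R (k - m) in b0 h *.
set c := Znorm R k in c0 h *; nra.
Qed.

Lemma schwartzZ_translate_conj g m : schwartzZ g ->
  schwartzZ (fun k => (g (k - m))^*).
Proof.
move=> gS N; have [B gB] := gS N; exists ((1 + Znorm R m) ^+ N * B) => k.
rewrite normc_conj.
apply: (@le_trans _ _ ((1 + Znorm R m) ^+ N *
    ((1 + Znorm R (k - m)) ^+ N * normc (g (k - m))))); last first.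
  by rewrite ler_wpM2l// exprn_ge0// addr_ge0// Znorm_ge0.
by rewrite mulrA ler_wpM2r ?normc_ge0// weight_shift_le.
Qed.

Lemma stftZE g f m w : stftZ g f (m, w) =
  csum (fun k => f k * (g (k - m))^* * (echar k w)^*).
Proof.
rewrite /stftZ /inner; apply: eq_cintegral => k.
by rewrite /modulate /translate conjcM mulrA mulrAC.
Qed.

(** The product of the two discrete sigma-algebras is discrete because the
    lattice is countable. *)
Lemma measurable_Zn2 d (T : measurableType d) (h : Zn n * Zn n -> T) :
  measurable_fun setT h.
Proof.
move=> _ A _; rewrite setTI.
have -> : h @^-1` A = \bigcup_(y : Zn n * Zn n)
    (if h y \in A then [set y.1] `*` [set y.2] else set0).
  apply/seteqP; split => [y Ay|y [z _]].
    by exists y => //=; rewrite mem_set.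
  by case: ifPn => // /set_mem Ak [/= yz1 yz2]; case: y z yz1 yz2 Ak => ? ? [? ?] /= -> ->.
apply: countable_bigcupT_measurable; first exact: countableP.
by move=> y; case: ifPn => // _; exact: measurableX.
Qed.

Lemma cmeasurable_stftZ g f : cmeasurable (stftZ g f).
Proof.
pose F (z : (Zn n * 'rV[R]_n) * Zn n) : R[i] :=
  f z.2 * (g (z.2 - z.1.1))^* * (echar z.2 z.1.2)^*.
suff mF : cmeasurable F.
  have := cmeasurable_cintegral_r mu mF.
  by congr cmeasurable; apply/funext => -[m w]; rewrite stftZE.
apply: cmeasurableM.
- apply: (cmeasurable_comp
    (f := fun y : Zn n * Zn n => f y.2 * (g (y.2 - y.1))^*)
    (h := fun z : (Zn n * 'rV[R]_n) * Zn n => (z.1.1, z.2))).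
    by split; exact: measurable_Zn2.
  by apply: measurable_fun_pair => //; exact: measurableT_comp.
- apply: cmeasurable_conj.
  apply: (cmeasurable_comp (@cmeasurable_echar2 R n)
    (h := fun z : (Zn n * 'rV[R]_n) * Zn n => (z.2, z.1.2))).
  by apply: measurable_fun_pair => //; exact: measurableT_comp.
Qed.

Lemma cmeasurable_stftZ_w g f m : cmeasurable (fun w => stftZ g f (m, w)).
Proof.
exact: (cmeasurable_comp (cmeasurable_stftZ g f) (pair1_measurable m)).
Qed.

Lemma csum_delta k (z : R[i]) :
  csum (fun k' => if k' == k then z else 0) = z.
Proof.
have delta (a : R) : \int[mu]_k' (if k' == k then a else 0) = a.
  rewrite /Rintegral -[RHS]/(fine a%:E) -(integral_counting_set1 k (fun=> a%:E)).
  rewrite [in RHS]integral_mkcond; congr fine; apply: eq_integral => k' _.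
  rewrite patchE; have [->|/eqP k'k] := eqVneq k' k; first by rewrite mem_set.
  by rewrite memNset.
apply: complex_ext; rewrite /csum /cintegral /=.
- by rewrite -[RHS]delta; apply: eq_Rintegral => k' _; case: ifP.
- by rewrite -[RHS]delta; apply: eq_Rintegral => k' _; case: ifP.
Qed.

(** Orthogonality of the characters, applied term by term: absolute convergence
    allows the sum and the integral to be exchanged. *)
Lemma fourier_coef_csum (a : Zn n -> R[i]) k : csummable a ->
  cintegral haar (fun w => echar k w * csum (fun k' => a k' * (echar k' w)^*))
  = a k.
Proof.
move=> suma.
pose F (z : 'rV[R]_n * Zn n) : R[i] := echar k z.1 * (a z.2 * (echar z.2 z.1)^*).
have mF : cmeasurable F.
  apply: cmeasurableM.
    exact: (cmeasurable_comp (cmeasurable_echar R k) measurable_fst).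
  apply: cmeasurableM.
    have ma : cmeasurable a by split.
    exact: (cmeasurable_comp ma measurable_snd).
  apply: cmeasurable_conj.
  apply: (cmeasurable_comp (@cmeasurable_echar2 R n)
    (h := fun z : 'rV[R]_n * Zn n => (z.2, z.1))).
  exact: measurable_fun_pair.
have slice w : csummable (fun k' => a k' * (echar k' w)^*).
  apply: (@cintegrable_normc_le _ _ _ _ _ a) => // k'.
  by rewrite normcM normc_conj normc_echar mulr1.
transitivity (cintegral haar (fun w => cintegral mu (fun k' => F (w, k')))).
  by apply: eq_cintegral => w; rewrite -cintegralZ//; exact: slice.
rewrite (@cFubini _ _ _ _ _ haar mu F (fun=> 1) (fun k' => normc (a k')))//.
- rewrite -[RHS](csum_delta k); apply: eq_cintegral => k' /=.
  under eq_cintegral => w do rewrite /F /= mulrCA -echarNr -echarDr.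
  rewrite cintegralZ; last exact: cintegrable_echar.
  rewrite cintegral_echar subr_eq0 eq_sym; case: eqP => [->|_].
    by rewrite mulr1.
  by rewrite mulr0.
- exact: finite_measure_integrable_cst.
- exact: integrable_normc.
- by move=> k'; exact: normc_ge0.
- by move=> w k'; rewrite !normcM normc_conj !normc_echar mulr1.
Qed.

Lemma stftZ_coef_le g f k m : csummable (fun k' => f k' * (g (k' - m))^*) ->
  ((normc (f k) * normc (g (k - m)))%:E <=
   \int[haar]_w (normc (stftZ g f (m, w)))%:E)%E.
Proof.
move=> sfg; rewrite -[normc (g _)]normc_conj -normcM.
rewrite -(fourier_coef_csum k sfg).
under eq_cintegral => w do rewrite -stftZE.
apply: le_trans.
  apply: normc_cintegral_le; apply: cmeasurableM.
    exact: cmeasurable_echar.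
  exact: cmeasurable_stftZ_w.
by under eq_integral do rewrite normcM normc_echar mul1r.
Qed.

Lemma temperedZ_csummable g f m : schwartzZ g -> temperedZ f ->
  csummable (fun k => f k * (g (k - m))^*).
Proof. by move=> gS [fS _]; apply/fS/schwartzZ_translate_conj. Qed.

Lemma fubini_haarZT (f : Zn n * 'rV[R]_n -> \bar R) :
  measurable_fun setT f -> (forall y, 0 <= f y)%E ->
  (\int[haarZT R n]_y f y = \int[mu]_m \int[haar]_w f (m, w))%E.
Proof. by move=> mf f0; rewrite /haarZT fubini_tonelli1. Qed.

Lemma cLnorm_slice_le (V : Zn n * 'rV[R]_n -> R[i]) (p : R) m :
  1 <= p -> cmeasurable V ->
  (\int[haar]_w (normc (V (m, w)))%:E <= cLnorm (haarZT R n) p V)%E.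
Proof.
move=> p1 mV; have p0 : 0 < p by rewrite (lt_le_trans _ p1).
have mVm : cmeasurable (fun w => V (m, w)).
  exact: (cmeasurable_comp mV (pair1_measurable m)).
rewrite (le_trans (integral_normc_le_cLnorm _ p1 mVm))// !cLnorm_powK//.
apply: gt0_ler_poweR.
- by rewrite invr_ge0 ltW.
- rewrite in_itv /= leey andbT; apply: integral_ge0 => w _.
  by rewrite lee_fin powR_ge0.
- rewrite in_itv /= leey andbT; apply: integral_ge0 => w _.
  by rewrite lee_fin powR_ge0.
rewrite fubini_haarZT; last 2 first.
- exact: measurable_normc_powR.
- by move=> y; rewrite lee_fin powR_ge0.
apply: (ge0_integral_counting_ge
  (f := fun m => \int[haar]_w (normc (V (m, w)) `^ p)%:E)%E) => k.
by apply: integral_ge0 => w _; rewrite lee_fin powR_ge0.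
Qed.

Lemma neq0_normc_gt0 g : g <> 0 -> exists k0, 0 < normc (g k0).
Proof.
move=> /eqP gN0; apply: contrapT => /forallNP h; case/eqP: gN0.
apply/funext => k0; apply/eqP; rewrite -normc_eq0 eq_le normc_ge0 andbT leNgt.
exact/negP/h.
Qed.

(** The embedding of M^p in l^oo: apply [stftZ_coef_le] with [m := k - k0], where
    [g k0] is not zero. *)
Lemma MnormZ_sup_le g (p : R) : schwartzZ g -> g <> 0 -> 1 <= p ->
  exists2 C : R, 0 < C &
    forall f k, (forall m, csummable (fun k => f k * (g (k - m))^*)) ->
      ((normc (f k))%:E <= C%:E * MnormZ g p f)%E.
Proof.
move=> gS gN0 p1.
have [k0 gk0] := neq0_normc_gt0 gN0.
exists (normc (g k0))^-1; first by rewrite invr_gt0.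
move=> f k fg.
have := stftZ_coef_le k (fg (k - k0)).
rewrite subKr EFinM muleC -lee_pdivlMl// => /le_trans; apply.
apply: lee_wpmul2l; first by rewrite lee_fin invr_ge0 ltW.
exact/cLnorm_slice_le/cmeasurable_stftZ.
Qed.

(** The embedding of M^1 in l^1: sum the same inequality over [k]. *)
Lemma MZ1_summable g f : schwartzZ g -> g <> 0 -> MZ g 1 f -> csummable f.
Proof.
move=> gS gN0 [fT [mV]]; rewrite cLnorm1 => Voo; apply/csummableP.
have [k0 gk0] := neq0_normc_gt0 gN0.
have V0 (h : Zn n * 'rV[R]_n -> R[i]) k :
    (0 <= \int[haar]_w (normc (h (k, w)))%:E)%E.
  by apply: integral_ge0 => w _; rewrite lee_fin normc_ge0.
suff : ((normc (g k0))%:E * \int[mu]_k (normc (f k))%:E < +oo)%E.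
  apply: contraTT; rewrite -!leNgt !leye_eq => /eqP ->.
  by rewrite gt0_muley ?lte_fin.
apply: le_lt_trans Voo; rewrite fubini_haarZT; last 2 first.
- exact: measurable_normcE.
- by move=> y; rewrite lee_fin normc_ge0.
rewrite -[leRHS](integral_counting_shift k0)//.
rewrite -ge0_integralZl//; last 2 first.
- by move=> k _; rewrite lee_fin normc_ge0.
- by rewrite lee_fin normc_ge0.
apply: ge0_le_integral => //.
- by move=> k _; rewrite -EFinM lee_fin mulr_ge0 ?normc_ge0.
move=> k _.
have := stftZ_coef_le k (temperedZ_csummable (k - k0) gS fT).
by rewrite subKr mulrC EFinM.
Qed.

Variable g : Zn n -> R[i].
Hypothesis g_schwartz : schwartzZ g.

Lemma normc_stftZ_le u m w :
  ((normc (stftZ g u (m, w)))%:E <=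
   \int[mu]_k (normc (u k) * normc (g (k - m)))%:E)%E.
Proof.
rewrite stftZE; apply: le_trans.
  by apply: normc_cintegral_le; split.
by under eq_integral do rewrite !normcM !normc_conj normc_echar mulr1.
Qed.

Lemma normc_le_l1 u k (A : R) :
  (\int[mu]_k (normc (u k))%:E <= A%:E)%E -> normc (u k) <= A.
Proof.
rewrite -lee_fin; apply: le_trans.
apply: (ge0_integral_counting_ge (f := fun k => (normc (u k))%:E)) => k'.
by rewrite lee_fin normc_ge0.
Qed.

Lemma temperedZ_l1 u : csummable u -> temperedZ u.
Proof.
move=> su.
have suphi phi : schwartzZ phi -> csummable (fun k => u k * phi k).
  move=> /(_ 0%N)[B phiB].
  apply: (@cintegrable_normc_le _ _ _ _ _ (fun k => B%:C * u k)).
  - by split.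
  - exact: cintegrableZ.
  - move=> k; rewrite !normcM normc_real mulrC ler_wpM2r ?normc_ge0//.
    by have := phiB k; rewrite expr0 mul1r => /le_trans; apply; exact: ler_norm.
split=> //; split.
- move=> a phi psi phiS psiS.
  transitivity (csum (fun k => a * (u k * phi k) + u k * psi k)).
    apply: eq_cintegral => k.
    by rewrite mulrCA -mulrDr.
  rewrite /csum cintegralD; [|exact/cintegrableZ/suphi|exact: suphi].
  by rewrite cintegralZ//; exact: suphi.
- have [I0 IE] : exists I0 : R, (\int[mu]_k (normc (u k))%:E = I0%:E)%E.
    exists (fine (\int[mu]_k (normc (u k))%:E)); rewrite fineK//.
    rewrite ge0_fin_numE; first exact/csummableP.
    by apply: integral_ge0 => k _; rewrite lee_fin normc_ge0.
  exists 0%N, I0 => phi phiS B phiB.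
  have phiB' k : normc (phi k) <= B.
    by have := phiB k; rewrite expr0 mul1r.
  have B0 : 0 <= B by rewrite (le_trans _ (phiB' 0))// normc_ge0.
  apply: normc_cintegral_bound; first exact: suphi.
  rewrite EFinM -IE muleC -ge0_integralZl//; last first.
    by move=> k _; rewrite lee_fin normc_ge0.
  apply: ge0_le_integral => //.
  + by move=> k _; rewrite lee_fin normc_ge0.
  + by move=> k _; rewrite -EFinM lee_fin normcM mulrC ler_wpM2r ?normc_ge0.
Qed.

Lemma integral_stftZ_le u :
  (\int[haarZT R n]_y (normc (stftZ g u y))%:E <=
   \int[mu]_k (normc (u k))%:E * \int[mu]_k (normc (g k))%:E)%E.
Proof.
have nn0 (v : Zn n -> R[i]) k : (0 <= (normc (v k))%:E)%E.
  by rewrite lee_fin normc_ge0.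
rewrite fubini_haarZT; last 2 first.
- exact/measurable_normcE/cmeasurable_stftZ.
- by move=> y; rewrite lee_fin normc_ge0.
apply: (@le_trans _ _ (\int[mu]_m \int[mu]_k
    (normc (u k) * normc (g (k - m)))%:E)%E).
  apply: ge0_le_integral => //.
    by move=> m _; apply: integral_ge0 => w _; rewrite lee_fin normc_ge0.
  move=> m _; apply: (@le_trans _ _ (\int[haar]_w (cst
      (\int[mu]_k (normc (u k) * normc (g (k - m)))%:E) w))%E).
    apply: ge0_le_integral => //.
    - by move=> w _; rewrite lee_fin normc_ge0.
    - exact/measurable_normcE/cmeasurable_stftZ_w.
    - by move=> w _; exact: normc_stftZ_le.
  rewrite integral_cst// [X in (_ * X)%E](_ : _ = 1%E) ?mule1//.
  exact: probability_setT.
rewrite (fubini_tonelli (fun z : Zn n * Zn n =>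
    (normc (u z.2) * normc (g (z.2 - z.1)))%:E)); last 2 first.
- exact: measurable_Zn2.
- by move=> z; rewrite lee_fin mulr_ge0 ?normc_ge0.
rewrite -ge0_integralZr//; last exact: integral_ge0.
apply: ge0_le_integral => //.
- by move=> k _; apply: integral_ge0 => m _; rewrite lee_fin mulr_ge0 ?normc_ge0.
move=> k _ /=; under eq_integral do rewrite EFinM.
rewrite ge0_integralZl// (integral_counting_reflect k (f := fun k => (normc (g k))%:E))//.
Qed.

(** The embedding of l^1 in M^p: the short-time Fourier transform of [u] is
    dominated by the convolution of [u] with the reflected window, both in the
    sup norm and in the L^1 norm. *)
Lemma MnormZ_le_l1 (p A Ag : R) u : 1 <= p ->
  (\int[mu]_k (normc (u k))%:E <= A%:E)%E ->
  (\int[mu]_k (normc (g k))%:E <= Ag%:E)%E ->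
  (MnormZ g p u <= (A * Ag)%:E)%E.
Proof.
move=> p1 uA gAg.
have uI0 : (0 <= \int[mu]_k (normc (u k))%:E)%E.
  by apply: integral_ge0 => k _; rewrite lee_fin normc_ge0.
have gI0 : (0 <= \int[mu]_k (normc (g k))%:E)%E.
  by apply: integral_ge0 => k _; rewrite lee_fin normc_ge0.
have Ag0 : 0 <= Ag by rewrite -lee_fin (le_trans gI0).
apply: cLnorm_le_interp => //; first exact: cmeasurable_stftZ.
- move=> [m w]; rewrite -lee_fin (le_trans (normc_stftZ_le _ _ _))//.
  apply: (@le_trans _ _ (\int[mu]_k ((normc (u k))%:E * Ag%:E))%E).
    apply: ge0_le_integral => //.
    + by move=> k _; rewrite lee_fin mulr_ge0 ?normc_ge0.
    + move=> k _; rewrite -EFinM lee_fin ler_wpM2l ?normc_ge0//.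
      exact: normc_le_l1.
  rewrite ge0_integralZr//; last by move=> k _; rewrite lee_fin normc_ge0.
  by rewrite EFinM; apply: lee_wpmul2r; rewrite ?lee_fin.
- by rewrite (le_trans (integral_stftZ_le _))// EFinM; exact: lee_pmul.
Qed.

Lemma MZ_csummable (p : R) u : 1 <= p -> csummable u -> MZ g p u.
Proof.
move=> p1 su; split; first exact: temperedZ_l1.
split; first exact: cmeasurable_stftZ.
have /fineK gE : (\int[mu]_k (normc (g k))%:E)%E \is a fin_num.
  rewrite ge0_fin_numE; first exact: schwartzZ_summable.
  by apply: integral_ge0 => k _; rewrite lee_fin normc_ge0.
have /fineK uE : (\int[mu]_k (normc (u k))%:E)%E \is a fin_num.
  rewrite ge0_fin_numE; first exact/csummableP.
  by apply: integral_ge0 => k _; rewrite lee_fin normc_ge0.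
apply: le_lt_trans (ltry (fine (\int[mu]_k (normc (u k))%:E)
  * fine (\int[mu]_k (normc (g k))%:E))).
by apply: MnormZ_le_l1 => //; rewrite ?uE ?gE.
Qed.

End stft_lattice.

(** * Fourier coefficients of symbols in M^1 *)

Section schwartz_slices.
Variables (R : realType) (n : nat).
Implicit Types (x : 'rV[R]_n) (j m : Zn n).

(** The mean value theorem along a coordinate line. *)
Lemma partial_bounded_lipschitz (h : 'rV[R]_n -> R) (i : 'I_n) (B : R) :
  (forall x, derivable h x (delta_mx 0 i)) ->
  (forall x, `|'D_(delta_mx 0 i) h x| <= B) ->
  forall x t, `|h (x + t *: delta_mx 0 i) - h x| <= B * `|t|.
Proof.
move=> dh hB.
have pos x t : 0 <= t -> `|h (x + t *: delta_mx 0 i) - h x| <= B * t.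
  move=> t0; pose phi (u : R) := h (x + u *: delta_mx 0 i).
  have quot u : (fun e : R => e^-1 *: ((phi \o shift u) (e *: 1) - phi u)) =
      (fun e : R => e^-1 *: ((h \o shift (x + u *: delta_mx 0 i))
        (e *: delta_mx 0 i) - h (x + u *: delta_mx 0 i))).
    apply/funext => e; rewrite /phi /= [e *: 1]mulr1 scalerDl.
    by rewrite addrCA.
  have dphi u : derivable phi u 1.
    by rewrite /derivable quot; exact: dh.
  have Dphi u : 'D_1 phi u = 'D_(delta_mx 0 i) h (x + u *: delta_mx 0 i).
    by rewrite /derive quot.
  have [||c _] := @MVT_segment R phi (fun u => 'D_1 phi u) 0 t t0.
  - by move=> u _; exact/derivableP.
  - by apply: derivable_within_continuous => u _; exact: dphi.
  rewrite /phi scale0r addr0 subr0 => ->; rewrite normrM (ger0_norm t0).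
  by rewrite ler_wpM2r// Dphi.
move=> x t; have [t0|t0] := leP 0 t; first by rewrite (ger0_norm t0) pos.
have := pos (x + t *: delta_mx 0 i) (- t).
rewrite -addrA -scalerDl subrr scale0r addr0 distrC (ltr0_norm t0); apply.
by rewrite oppr_ge0 ltW.
Qed.

Lemma schwartzZT_bounded (G : Zn n * 'rV[R]_n -> R[i]) : schwartzZT G ->
  exists B : R, forall j x, normc (G (j, x)) <= B.
Proof.
move=> [_ _ /(_ 0%N)[B GB]]; exists B => j x.
have := GB [::] isT j x; rewrite expr0 mul1r /cpartial /=.
by case: (G (j, x)).
Qed.

Lemma schwartzZT_slice_lipschitz (G : Zn n * 'rV[R]_n -> R[i]) : schwartzZT G ->
  exists L : R, forall j, coord_lipschitz L (fun x => G (j, x)).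
Proof.
move=> [_ Gsm /(_ 1%N)[B GB]]; exists (B + B) => j x i t.
have dB y : normc (cpartial [:: i] (fun x => G (j, x)) y) <= B.
  apply: le_trans (GB [:: i] isT j y).
  rewrite -[leLHS]mul1r ler_wpM2r ?normc_ge0// expr1 lerDl; exact: Znorm_ge0.
have [smR smI] := Gsm j.
have /= dR := (smR [::]).2 i; have /= dI := (smI [::]).2 i.
rewrite (le_trans (normc_le_ReIm _))// mulrDl ReD ReN ImD ImN lerD//.
- apply: (partial_bounded_lipschitz dR) => y.
  by apply: le_trans (dB y); exact: (normc_Re_le (cpartial [:: i] _ y)).
- apply: (partial_bounded_lipschitz dI) => y.
  by apply: le_trans (dB y); exact: (normc_Im_le (cpartial [:: i] _ y)).
Qed.

Lemma cmeasurable_schwartzZT_slice (G : Zn n * 'rV[R]_n -> R[i]) j :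
  schwartzZT G -> cmeasurable (fun x => G (j, x)).
Proof.
by move=> /schwartzZT_slice_lipschitz[L GL]; exact: cmeasurable_coord_lipschitz (GL j).
Qed.

Lemma partial_cst (s : seq 'I_n) (c : R) :
  partial s (fun=> c) = (fun=> if s is [::] then c else 0) :> ('rV[R]_n -> R).
Proof.
elim: s => //= i s ih; rewrite ih; apply/funext => x; exact: derive_cst.
Qed.

Lemma smooth_cst (c : R) : smooth (fun _ : 'rV[R]_n => c).
Proof.
move=> s; rewrite partial_cst; split; first exact: cst_continuous.
by move=> i x; exact: derivable_cst.
Qed.

Lemma schwartzZT_lattice (Phi : Zn n -> R) :
  (forall N, exists B, forall j, (1 + Znorm R j) ^+ N * `|Phi j| <= B) ->
  schwartzZT (fun y : Zn n * 'rV[R]_n => (Phi y.1)%:C).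
Proof.
move=> PhiB; split=> //.
  by move=> j; split => /=; exact: smooth_cst.
move=> N; have [B PB] := PhiB N; exists B => s _ j x.
have -> : cpartial s (fun x => (Phi (j, x).1)%:C) x =
    (if s is [::] then Phi j else 0)%:C.
  by rewrite /cpartial /= !partial_cst; case: s.
rewrite normc_real; case: s => [|i s]; first exact: PB.
rewrite normr0 mulr0 (le_trans _ (PB 0))//.
by rewrite mulr_ge0// exprn_ge0// addr_ge0// Znorm_ge0.
Qed.

Lemma Zn_to_rVN m : Zn_to_rV R (- m) = - Zn_to_rV R m.
Proof. by apply/rowP => i; rewrite !mxE mulrNz. Qed.

(** Taking the supremum over the torus variable gives a bound that no torus
    translation affects, so that no derivative of a translate is needed. *)
Lemma schwartzZT_dominated (G : Zn n * 'rV[R]_n -> R[i]) m : schwartzZT G ->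
  exists Phi : Zn n -> R,
    schwartzZT (fun y : Zn n * 'rV[R]_n => (Phi y.1)%:C) /\
    forall j x, normc (G (j - m, x)) <= Phi j.
Proof.
move=> GS; have [B GB] := schwartzZT_bounded GS.
pose E j := [set normc (G (j - m, x)) | x in [set: 'rV[R]_n]].
have supE j : has_sup (E j).
  split; first by exists (normc (G (j - m, 0))), 0.
  by exists B => _ [x _ <-].
have Phi_ub j x : normc (G (j - m, x)) <= sup (E j).
  by apply: sup_upper_bound => //; exists x.
have Phi0 j : 0 <= sup (E j) by rewrite (le_trans _ (Phi_ub j 0))// normc_ge0.
exists (fun j => sup (E j)); split => //.
apply: (schwartzZT_lattice (Phi := fun j => sup (E j))) => N.
have [_ _ /(_ N)[C GC]] := GS.
exists ((1 + Znorm R m) ^+ N * C) => j; rewrite ger0_norm//.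
have w0 l : 0 < 1 + Znorm R l by rewrite ltr_pwDl// Znorm_ge0.
apply: (@le_trans _ _ ((1 + Znorm R m) ^+ N *
    ((1 + Znorm R (j - m)) ^+ N * sup (E j)))).
  by rewrite mulrA ler_wpM2r// weight_shift_le.
apply: ler_wpM2l; first by rewrite exprn_ge0// ltW.
rewrite -ler_pdivlMl ?exprn_gt0//.
apply: ge_sup; first by case: (supE j).
move=> _ [x _ <-]; rewrite ler_pdivlMl ?exprn_gt0//.
by have := GC [::] isT (j - m) x; rewrite /cpartial /=; case: (G _).
Qed.

End schwartz_slices.

Section symbol.
Variables (R : realType) (n : nat).
Local Notation mu := (@counting (Zn n) R).
Local Notation haar := (haar R n).
Variable sigma : Zn n * 'rV[R]_n -> R[i].
Hypothesis sigma_tempered : temperedZT sigma.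
Implicit Types (x w eta omega xi : 'rV[R]_n) (j k l m : Zn n).

Lemma cmeasurable_symbol_slice j : cmeasurable (fun x => sigma (j, x)).
Proof.
have [_ ms _ _] := sigma_tempered.
exact: (cmeasurable_comp ms (pair1_measurable j)).
Qed.

Lemma symbol_dominated_summable (Phi : Zn n -> R) :
  schwartzZT (fun y : Zn n * 'rV[R]_n => (Phi y.1)%:C) ->
  (\int[mu]_j \int[haar]_x (normc (sigma (j, x)) * `|Phi j|)%:E < +oo)%E.
Proof.
have [_ ms isig _] := sigma_tempered.
move=> /isig /cintegrableP[mF]; rewrite fubini_haarZT; last 2 first.
- exact: measurable_normcE.
- by move=> y; rewrite lee_fin normc_ge0.
congr (_ < _)%E; apply: eq_integral => j _; apply: eq_integral => x _.
by rewrite normcM normc_real.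
Qed.

Lemma cintegrable_symbol_slice j : cintegrable haar (fun x => sigma (j, x)).
Proof.
apply/cintegrableP; split; first exact: cmeasurable_symbol_slice.
(* The indicator function of the fibre over [j] is a Schwartz function. *)
pose Phi k : R := (k == j)%:R.
have PhiS : schwartzZT (fun y : Zn n * 'rV[R]_n => (Phi y.1)%:C).
  apply: schwartzZT_lattice => N; exists ((1 + Znorm R j) ^+ N) => k.
  have j0 : 0 <= (1 + Znorm R j) ^+ N.
    by rewrite exprn_ge0// addr_ge0// Znorm_ge0.
  by rewrite /Phi; case: eqP => [->|_]; rewrite ?normr1 ?mulr1// normr0 mulr0.
apply: le_lt_trans (symbol_dominated_summable PhiS).
apply: le_trans (ge0_integral_counting_ge
  (f := fun k => (\int[haar]_x (normc (sigma (k, x)) * `|Phi k|)%:E)%E) j _).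
  by rewrite /Phi eqxx normr1; under [leRHS]eq_integral do rewrite mulr1.
by move=> k; apply: integral_ge0 => x _; rewrite lee_fin mulr_ge0// normc_ge0.
Qed.

Definition symbol_coef m l : R[i] :=
  cintegral haar (fun x => sigma (m, x) * echar l x).

Variable G : Zn n * 'rV[R]_n -> R[i].
Hypothesis G_schwartz : schwartzZT G.

Let cmeasurable_G j : cmeasurable (fun x => G (j, x)).
Proof. exact: cmeasurable_schwartzZT_slice. Qed.

(** For fixed [m], [omega] and [k], these are the coefficients of the
    trigonometric series [xi |-> V_G sigma ((m, omega), (xi, k))]; see [stftZTE]. *)
Definition windowed_coef m k j omega : R[i] := cintegral haar (fun x =>
  (echar k x)^* * (sigma (j, x) * (G (j - m, x - omega))^*)).

Let cintegrable_windowed m k j omega : cintegrable haar (fun x =>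
  (echar k x)^* * (sigma (j, x) * (G (j - m, x - omega))^*)).
Proof.
have [B GB] := schwartzZT_bounded G_schwartz.
apply: (@cintegrable_normc_le _ _ _ _ _ (fun x => B%:C * sigma (j, x))).
- apply: cmeasurableM; first exact/cmeasurable_conj/cmeasurable_echar.
  apply: cmeasurableM; first exact: cmeasurable_symbol_slice.
  exact/cmeasurable_conj/(cmeasurable_comp (cmeasurable_G (j - m))
    (measurable_rV_shift (- omega))).
- exact/cintegrableZ/cintegrable_symbol_slice.
- move=> x; rewrite !normcM !normc_conj normc_echar mul1r mulrC normc_real.
  by rewrite ler_wpM2r ?normc_ge0// (le_trans (GB _ _))// ler_norm.
Qed.

Let cmeasurable_windowed2 m k j : cmeasurable
  (fun z : 'rV[R]_n * 'rV[R]_n =>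
    (echar k z.2)^* * (sigma (j, z.2) * (G (j - m, z.2 - z.1))^*)).
Proof.
have m2 : measurable_fun setT (fun z : 'rV[R]_n * 'rV[R]_n => z.2).
  exact: measurable_snd.
apply: cmeasurableM.
  exact/cmeasurable_conj/(cmeasurable_comp (cmeasurable_echar R k) m2).
apply: cmeasurableM.
  exact: (cmeasurable_comp (cmeasurable_symbol_slice j) m2).
apply/cmeasurable_conj/(cmeasurable_comp (cmeasurable_G (j - m))
  (h := fun z : 'rV[R]_n * 'rV[R]_n => z.2 - z.1)).
apply: measurable_fun_rV => i; under eq_fun do rewrite !mxE.
by apply: measurable_funB; exact: (measurableT_comp (measurable_coor i)).
Qed.

Lemma cmeasurable_windowed_coef m k j :
  cmeasurable (fun omega => windowed_coef m k j omega).
Proof. exact: (cmeasurable_cintegral_r haar (cmeasurable_windowed2 m k j)). Qed.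

Lemma stftZTE m omega xi k : stftZT G sigma ((m, omega), (xi, k)) =
  csum (fun j => windowed_coef m k j omega * (echar j xi)^*).
Proof.
apply: eq_cintegral => j; rewrite mulrC -cintegralZ//.
by apply: eq_cintegral => x; rewrite -!cis2piN !mulrA.
Qed.

Lemma csummable_windowed m k omega :
  csummable (fun j => windowed_coef m k j omega).
Proof.
have [Phi [PhiS GPhi]] := schwartzZT_dominated m G_schwartz.
apply/csummableP; apply: le_lt_trans (symbol_dominated_summable PhiS).
apply: ge0_le_integral => //.
  by move=> j _; rewrite lee_fin normc_ge0.
move=> j _; apply: le_trans.
  exact: normc_cintegral_le (cintegrable_cmeasurable (cintegrable_windowed _ _ _ _)).
apply: ge0_le_integral => //.
- by move=> x _; rewrite lee_fin normc_ge0.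
- exact/measurable_normcE/cintegrable_cmeasurable/cintegrable_windowed.
- apply/measurable_EFinP; apply: measurable_funM => //.
  exact/measurable_normc/cmeasurable_symbol_slice.
- move=> x _; rewrite lee_fin !normcM !normc_conj normc_echar mul1r.
  by rewrite ler_wpM2l ?normc_ge0// (le_trans (GPhi _ _))// ler_norm.
Qed.

Definition window_coef j q : R[i] :=
  cintegral haar (fun omega => echar q omega * (G (j, - omega))^*).

(** Fourier transform in the variable [omega]: the translated window turns
    into a character times a Fourier coefficient of the window. *)
Lemma windowed_coef_fourier m k j q :
  cintegral haar (fun omega => echar q omega * windowed_coef m k j omega) =
  window_coef (j - m) q * symbol_coef j (q - k).
Proof.
have [B GB] := schwartzZT_bounded G_schwartz.
have B0 : 0 <= B by rewrite (le_trans _ (GB 0 0))// normc_ge0.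
have [Gper _ _] := G_schwartz.
pose F (z : 'rV[R]_n * 'rV[R]_n) : R[i] := echar q z.1 *
  ((echar k z.2)^* * (sigma (j, z.2) * (G (j - m, z.2 - z.1))^*)).
have m1 : measurable_fun setT (fun z : 'rV[R]_n * 'rV[R]_n => z.1).
  exact: measurable_fst.
have mF : cmeasurable F.
  apply: cmeasurableM; last exact: cmeasurable_windowed2.
  exact: (cmeasurable_comp (cmeasurable_echar R q) m1).
transitivity (cintegral haar (fun omega => cintegral haar (fun x => F (omega, x)))).
  by apply: eq_cintegral => omega; rewrite -cintegralZ//.
rewrite (@cFubini _ _ _ _ _ haar haar F (fun=> 1)
  (fun x => normc (B%:C * sigma (j, x))))//; last 4 first.
- exact: finite_measure_integrable_cst.
- exact/integrable_normc/cintegrableZ/cintegrable_symbol_slice.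
- by move=> x; exact: normc_ge0.
- move=> omega x; rewrite /F !normcM !normc_conj !normc_echar !mul1r mulrC.
  by rewrite normc_real ler_wpM2r ?normc_ge0// (le_trans (GB _ _))// ler_norm.
rewrite /symbol_coef -cintegralZ; last first.
  apply: (@cintegrable_normc_le _ _ _ _ _ (fun x => sigma (j, x))).
  - apply: cmeasurableM; first exact: cmeasurable_symbol_slice.
    exact: cmeasurable_echar.
  - exact: cintegrable_symbol_slice.
  - by move=> x; rewrite normcM normc_echar mulr1.
apply: eq_cintegral => x.
pose H omega : R[i] := echar q omega * (G (j - m, x - omega))^*.
have mH : cmeasurable H.
  apply: cmeasurableM; first exact: cmeasurable_echar.
  apply/cmeasurable_conj/(cmeasurable_comp (cmeasurable_G (j - m))
    (h := fun omega => x - omega)).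
  apply: measurable_fun_rV => i; under eq_fun do rewrite !mxE.
  by apply: measurable_funB => //; exact: measurable_coor.
have iH : cintegrable haar H.
  apply: (@cintegrable_haar_bounded _ _ _ B) => // omega.
  by rewrite normcM normc_echar mul1r normc_conj.
have HE : cintegral haar H = echar q x * window_coef (j - m) q.
  rewrite -(@cintegral_haar_shift _ _ x H)//; last first.
    move=> omega l; rewrite /H echar_periodic opprD addrA.
    by rewrite -Zn_to_rVN Gper.
  rewrite /window_coef -cintegralZ.
    apply: eq_cintegral => omega; rewrite /H echarDl opprD addrCA subrr addr0.
    by rewrite mulrA [echar q omega * _]mulrC.
  apply: (@cintegrable_haar_bounded _ _ _ B).
    apply: cmeasurableM; first exact: cmeasurable_echar.
    apply/cmeasurable_conj/(cmeasurable_comp (cmeasurable_G (j - m))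
      (h := fun omega => - omega)).
    apply: measurable_fun_rV => i; under eq_fun do rewrite !mxE.
    by apply: measurableT_comp => //; exact: measurable_coor.
  by move=> omega; rewrite normcM normc_echar mul1r normc_conj.
transitivity ((echar k x)^* * sigma (j, x) * cintegral haar H).
  rewrite -cintegralZ//; apply: eq_cintegral => omega.
  by rewrite /F /H /=; ring.
by rewrite HE echarDr echarNr; ring.
Qed.

(** The conjugated reflection of a slice of [G] is Lipschitz and periodic, so
    [fourier_unique] applies to it. *)
Lemma window_coef_neq0 : G <> 0 -> exists j q, window_coef j q != 0.
Proof.
move=> /eqP G0; apply: contrapT => /forallNP h; case/eqP: G0.
apply/funext => -[j x0].
have [L GL] := schwartzZT_slice_lipschitz G_schwartz.
have [B GB] := schwartzZT_bounded G_schwartz.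
have [Gper _ _] := G_schwartz.
have := @fourier_unique R n (fun omega => (G (j, - omega))^*) L B _ _ _ _ (- x0).
rewrite opprK => H; apply/eqP; rewrite -conjC_eq0; apply/eqP/H.
- move=> x i t.
  have -> a b : (a : R[i])^* - b^* = (a - b)^* by rewrite rmorphB.
  by rewrite normc_conj opprD -scaleNr -(normrN t); exact: GL.
- by move=> x k; rewrite opprD -Zn_to_rVN Gper.
- by move=> x; rewrite normc_conj.
- move=> k; have /forallNP/(_ k)/negP := h j; rewrite negbK => /eqP <-.
  by apply: eq_cintegral => x; rewrite mulrC.
Qed.

Local Open Scope ereal_scope.

Let V := stftZT G sigma.

Let normV (y : (Zn n * 'rV[R]_n) * ('rV[R]_n * Zn n)) : \bar R := (normc (V y))%:E.

Let normV_ge0 y : 0 <= normV y.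
Proof. by rewrite lee_fin normc_ge0. Qed.

(** Fourier inversion in the variable [xi]. *)
Lemma windowed_coef_le m k j omega : cmeasurable V ->
  (normc (windowed_coef m k j omega))%:E <=
   \int[haarTZ R n]_z normV ((m, omega), z).
Proof.
move=> mV; have mVz : cmeasurable (fun z => V ((m, omega), z)).
  exact: (cmeasurable_comp mV (pair1_measurable (m, omega))).
have mVxi : cmeasurable (fun xi => V ((m, omega), (xi, k))).
  exact: (cmeasurable_comp mVz (pair2_measurable k)).
apply: (@le_trans _ _ (\int[haar]_xi normV ((m, omega), (xi, k)))).
  rewrite -(fourier_coef_csum j (csummable_windowed m k omega)).
  under eq_cintegral => xi do rewrite -stftZTE.
  apply: le_trans.
    by apply: normc_cintegral_le; apply: cmeasurableM => //; exact: cmeasurable_echar.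
  by under eq_integral do rewrite normcM normc_echar mul1r.
rewrite (eq_measure_integral (haar \x mu)) => [|A _ _]; last by [].
rewrite (@fubini_tonelli2 _ _ _ _ _ haar mu)//; last exact: measurable_normcE.
apply: (ge0_integral_counting_ge
  (f := fun k => \int[haar]_xi normV ((m, omega), (xi, k)))) => k'.
exact: integral_ge0.
Qed.

(** By [windowed_coef_fourier], [window_coef j0 q * symbol_coef m l] is an integral
    in [omega] of coefficients bounded by [windowed_coef_le]; summing over [m]
    gives at most the L^1 norm of the short-time Fourier transform. *)
Lemma symbol_coef_dominated : G <> 0%R -> inLp (haarZTTZ R n) 1 V ->
  exists s : Zn n -> R, [/\ forall m, (0 <= s m)%R,
    \int[mu]_m (s m)%:E < +oo & forall m l, (normc (symbol_coef m l) <= s m)%R].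
Proof.
move=> G0 [mV]; rewrite cLnorm1 => Voo.
have mN : measurable_fun setT normV by exact: measurable_normcE.
have [j0 [q cq0]] := window_coef_neq0 G0.
set c := normc (window_coef j0 q).
have c0 : (0 < c)%R by rewrite lt_neqAle normc_ge0 eq_sym normc_eq0 cq0.
pose H1 (y : Zn n * 'rV[R]_n) := \int[haarTZ R n]_z normV (y, z).
have mH1 : measurable_fun setT H1.
  exact: (@measurable_fun_fubini_tonelli_F _ _ _ _ _ (haarTZ R n) normV).
have H10 y : 0 <= H1 y by exact: integral_ge0.
pose H m := \int[haar]_omega H1 (m, omega).
have H0 m : 0 <= H m by exact: integral_ge0.
have sumH : \int[mu]_m H m < +oo.
  apply: le_lt_trans Voo.
  rewrite -(fubini_haarZT mH1 H10).
  (* Tonelli's theorem needs the first factor to be sigma-finite too. *)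
  have sfZT : sigma_finite setT (haarZT R n).
    have [F FT Foo] := sigma_finite_countZ R n.
    exists (fun i => F i `*` [set: 'rV[R]_n]).
      apply/seteqP; split => // -[k x] _.
      by have [i _ Fik] : (\bigcup_i F i) k by [rewrite -FT]; exists i.
    move=> i; have [mFi Fi] := Foo i; split; first exact: measurableX.
    have -> : haarZT R n (F i `*` [set: 'rV[R]_n]) = mu (F i) * haar setT.
      exact: product_measure1E.
    rewrite [X in _ * X](_ : _ = 1) ?mule1//.
    exact: probability_setT.
  pose sf := Measure_isSigmaFinite.Build _ _ _ (haarZT R n) sfZT.
  pose m1 : {sigma_finite_measure set _ -> \bar R} := HB.pack (Measure.sort (haarZT R n)) sf.
  have := @fubini_tonelli1 _ _ _ _ _ m1 (haarTZ R n) normV mN normV_ge0.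
  by rewrite /fubini_F => <-.
have Hfin m : (fine (H m))%:E = H m.
  rewrite fineK// ge0_fin_numE//; apply: le_lt_trans sumH.
  exact: ge0_integral_counting_ge.
have HE m l : c%:E * (normc (symbol_coef m l))%:E <= H (m - j0)%R.
  pose k := (q - l)%R.
  have -> : c%:E * (normc (symbol_coef m l))%:E = (normc (cintegral haar
      (fun omega => echar q omega * windowed_coef (m - j0) k m omega)%R))%:E.
    by rewrite windowed_coef_fourier normcM EFinM !subKr.
  have mw := cmeasurable_windowed_coef (m - j0)%R k m.
  apply: le_trans.
    apply: normc_cintegral_le; apply: cmeasurableM => //.
    exact: cmeasurable_echar.
  apply: ge0_le_integral => //.
  - by move=> omega _; rewrite lee_fin normc_ge0.
  - apply: measurable_normcE; apply: cmeasurableM => //.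
    exact: cmeasurable_echar.
  - exact: (measurableT_comp mH1 (pair1_measurable (m - j0)%R)).
  - move=> omega _; rewrite normcM normc_echar mul1r.
    exact: windowed_coef_le.
exists (fun m => c^-1 * fine (H (m - j0)))%R; split.
- by move=> m; rewrite mulr_ge0 ?fine_ge0// invr_ge0 ltW.
- under eq_integral do rewrite EFinM Hfin.
  rewrite ge0_integralZl//; last by rewrite lee_fin invr_ge0 ltW.
  rewrite integral_counting_shift//; apply: lte_mul_pinfty => //.
  by rewrite lee_fin invr_ge0 ltW.
- move=> m l; rewrite ler_pdivlMl// -lee_fin EFinM Hfin; exact: HE.
Qed.

End symbol.

(** * The localization operator *)

Section localization_bounds.
Variables (R : realType) (n : nat).
Local Notation mu := (@counting (Zn n) R).
Local Notation haar := (haar R n).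
Implicit Types (f u : Zn n -> R[i]) (w : 'rV[R]_n) (j k m : Zn n).

Variables (sigma : Zn n * 'rV[R]_n -> R[i]) (s : Zn n -> R).
Hypothesis sigma_slice : forall m, cintegrable haar (fun w => sigma (m, w)).
Hypothesis s_ge0 : forall m, 0 <= s m.
Hypothesis s_summable : (\int[mu]_m (s m)%:E < +oo)%E.
Hypothesis sigma_coef : forall m l, normc (symbol_coef sigma m l) <= s m.
Variables g1 g2 : Zn n -> R[i].
Hypotheses (g1_summable : csummable g1) (g2_summable : csummable g2).

Let l1 u : R := fine (\int[mu]_k (normc (u k))%:E)%E.

Let l1E u : csummable u -> (\int[mu]_k (normc (u k))%:E = (l1 u)%:E)%E.
Proof.
move=> /csummableP su; rewrite /l1 fineK// ge0_fin_numE//.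
by apply: integral_ge0 => k _; rewrite lee_fin normc_ge0.
Qed.

Let l1_ge0 u : 0 <= l1 u.
Proof. by rewrite fine_ge0// integral_ge0// => k _; rewrite lee_fin normc_ge0. Qed.

Let integral_normc_shift u m :
  (\int[mu]_k (normc (u (k - m)))%:E = \int[mu]_k (normc (u k))%:E)%E.
Proof.
apply: (integral_counting_shift m (f := fun k => (normc (u k))%:E)) => k.
by rewrite lee_fin normc_ge0.
Qed.

(** Up to the l^1 norm of [g1], the convolution of the modulus of [g2] with the
    bound [s] of the Fourier coefficients of the symbol. *)
Definition locop_bound k : R :=
  l1 g1 * fine (\int[mu]_m (normc (g2 (k - m)) * s m)%:E)%E.

Let integral_g2_s_fin k :
  (\int[mu]_m (normc (g2 (k - m)) * s m)%:E)%E \is a fin_num.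
Proof.
rewrite ge0_fin_numE; last first.
  by apply: integral_ge0 => m _; rewrite lee_fin mulr_ge0// normc_ge0.
apply: (@le_lt_trans _ _ (\int[mu]_m ((l1 g2)%:E * (s m)%:E))%E).
  apply: ge0_le_integral => //.
    by move=> m _; rewrite lee_fin mulr_ge0// normc_ge0.
  move=> m _; rewrite -EFinM lee_fin ler_wpM2r//.
  by apply: normc_le_l1; rewrite l1E.
rewrite ge0_integralZl ?lee_fin//; last by move=> m _; rewrite lee_fin.
by apply: lte_mul_pinfty => //; rewrite lee_fin.
Qed.

Section one_function.
Variables (f : Zn n -> R[i]) (A : R).
Hypothesis f_bounded : forall k, normc (f k) <= A.

Let A_ge0 : 0 <= A.
Proof. by rewrite (le_trans _ (f_bounded 0))// normc_ge0. Qed.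

Let integral_f_window m :
  (\int[mu]_k (normc (f k * (g1 (k - m))^*))%:E <= (A * l1 g1)%:E)%E.
Proof.
apply: (@le_trans _ _ (\int[mu]_k (A%:E * (normc (g1 (k - m)))%:E))%E).
  apply: ge0_le_integral => //.
    by move=> k _; rewrite lee_fin normc_ge0.
  move=> k _; rewrite -EFinM lee_fin normcM normc_conj.
  by rewrite ler_wpM2r ?normc_ge0.
rewrite ge0_integralZl//; last by move=> k _; rewrite lee_fin normc_ge0.
by rewrite integral_normc_shift l1E.
Qed.

Lemma csummable_bounded_window m : csummable (fun k => f k * (g1 (k - m))^*).
Proof.
by apply/csummableP; apply: le_lt_trans (integral_f_window m) (ltry _).
Qed.

Let normc_stftZ_bounded m w : normc (stftZ g1 f (m, w)) <= A * l1 g1.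
Proof.
rewrite stftZE; apply: normc_cintegral_bound.
  apply: (@cintegrable_normc_le _ _ _ _ _ (fun k => f k * (g1 (k - m))^*)).
  - by split.
  - exact: csummable_bounded_window.
  - by move=> k; rewrite [leLHS]normcM normc_conj normc_echar mulr1.
apply: le_trans (integral_f_window m).
by under eq_integral do rewrite normcM normc_conj normc_echar mulr1.
Qed.

Lemma cintegrable_locop_integrand k m : cintegrable haar
  (fun w => sigma (m, w) * stftZ g1 f (m, w) * modulate w (translate m g2) k).
Proof.
apply: (@cintegrable_normc_le _ _ _ _ _
    (fun w => ((A * l1 g1)%:C * g2 (k - m)) * sigma (m, w))).
- apply: cmeasurableM.
    apply: cmeasurableM; last exact: cmeasurable_stftZ_w.
    exact: cintegrable_cmeasurable (sigma_slice m).
  apply: cmeasurableM; first exact: (cmeasurable_echar R k).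
  exact: cmeasurable_cst.
- exact/cintegrableZ/sigma_slice.
- move=> w; rewrite /modulate /translate !normcM normc_cis2pi mul1r normc_real.
  rewrite [leRHS]mulrC -mulrA ler_wpM2l ?normc_ge0// ler_wpM2r ?normc_ge0//.
  by rewrite (le_trans (normc_stftZ_bounded _ _))// ler_norm.
Qed.

(** Expanding the short-time Fourier transform turns the integral over the
    torus into a sum of Fourier coefficients of the symbol. *)
Lemma locop_integral_le k m :
  normc (cintegral haar (fun w =>
    sigma (m, w) * stftZ g1 f (m, w) * modulate w (translate m g2) k)) <=
  A * l1 g1 * (normc (g2 (k - m)) * s m).
Proof.
pose a j := f j * (g1 (j - m))^*.
have sa : csummable a := csummable_bounded_window m.
pose F (z : 'rV[R]_n * Zn n) : R[i] := sigma (m, z.1) * (a z.2 * echar (k - z.2) z.1).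
have mF : cmeasurable F.
  apply: cmeasurableM.
    exact: (cmeasurable_comp (cintegrable_cmeasurable (sigma_slice m)) measurable_fst).
  apply: cmeasurableM.
    have ma : cmeasurable a by split.
    exact: (cmeasurable_comp ma measurable_snd).
  apply: (cmeasurable_comp (@cmeasurable_echar2 R n)
    (h := fun z : 'rV[R]_n * Zn n => (k - z.2, z.1))).
  apply: measurable_fun_pair => //.
  exact: (measurableT_comp (f := fun j => k - j)).
have slice w : csummable (fun j => a j * echar (k - j) w).
  apply: (@cintegrable_normc_le _ _ _ _ _ a) => // j.
  by rewrite normcM normc_echar mulr1.
have slice' w : csummable (fun j => a j * (echar j w)^*).
  apply: (@cintegrable_normc_le _ _ _ _ _ a) => // j.
  by rewrite normcM normc_conj normc_echar mulr1.
have FE w : cintegral mu (fun j => F (w, j)) =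
    sigma (m, w) * cintegral mu (fun j => a j * echar (k - j) w).
  exact: (cintegralZ (sigma (m, w)) (slice w)).
have E w : sigma (m, w) * stftZ g1 f (m, w) * modulate w (translate m g2) k =
    g2 (k - m) * cintegral mu (fun j => F (w, j)).
  rewrite FE stftZE /modulate /translate -/(echar k w) -/(a _).
  rewrite (_ : cintegral mu (fun j => a j * echar (k - j) w) =
     echar k w * csum (fun j => a j * (echar j w)^*)); first by ring.
  rewrite -cintegralZ; last exact: slice'.
  by apply: eq_cintegral => j; rewrite echarDr echarNr mulrCA.
under eq_cintegral do rewrite E.
have iF : cintegrable haar (fun w => cintegral mu (fun j => F (w, j))).
  apply: (@cintegrable_normc_le _ _ _ _ _ (fun w => (A * l1 g1)%:C * sigma (m, w))).
  - exact: cmeasurable_cintegral_r.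
  - exact/cintegrableZ/sigma_slice.
  - move=> w; rewrite FE !normcM mulrC ler_wpM2r ?normc_ge0// normc_real.
    rewrite ger0_norm ?mulr_ge0//; apply: normc_cintegral_bound => //.
      exact: slice.
    apply: le_trans (integral_f_window m).
    by under eq_integral do rewrite normcM normc_echar mulr1.
rewrite cintegralZ// normcM [leRHS]mulrCA ler_wpM2l ?normc_ge0//.
rewrite (@cFubini _ _ _ _ _ haar mu F (fun w => normc (sigma (m, w)))
  (fun j => normc (a j)))//; last 5 first.
- exact: integrable_normc.
- exact: integrable_normc.
- by move=> w; exact: normc_ge0.
- by move=> j; exact: normc_ge0.
- by move=> w j; rewrite !normcM normc_echar mulr1.
have E2 j : cintegral haar (fun w => F (w, j)) = a j * symbol_coef sigma m (k - j).
  rewrite -cintegralZ; first by apply: eq_cintegral => w; rewrite /F /= mulrCA.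
  apply: (@cintegrable_normc_le _ _ _ _ _ (fun w => sigma (m, w))) => //.
    apply: cmeasurableM; last exact: cmeasurable_echar.
    exact: cintegrable_cmeasurable (sigma_slice m).
  by move=> w; rewrite normcM normc_echar mulr1.
under eq_cintegral do rewrite E2.
have bnd : (\int[mu]_j (normc (a j * symbol_coef sigma m (k - j)))%:E <=
    (A * l1 g1 * s m)%:E)%E.
  apply: (@le_trans _ _ (\int[mu]_j ((normc (a j))%:E * (s m)%:E))%E).
    apply: ge0_le_integral => //.
      by move=> j _; rewrite lee_fin normc_ge0.
    by move=> j _; rewrite -EFinM lee_fin normcM ler_wpM2l ?normc_ge0.
  rewrite ge0_integralZr ?lee_fin//; last by move=> j _; rewrite lee_fin normc_ge0.
  rewrite EFinM; apply: lee_wpmul2r; first by rewrite lee_fin.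
  exact: integral_f_window.
apply: normc_cintegral_bound => //.
by apply/csummableP; apply: le_lt_trans bnd (ltry _).
Qed.

Lemma csummable_locop k : csummable (fun m => cintegral haar (fun w =>
  sigma (m, w) * stftZ g1 f (m, w) * modulate w (translate m g2) k)).
Proof.
apply: (@cintegrable_le _ _ _ _ _
    (fun m => A * l1 g1 * (normc (g2 (k - m)) * s m))).
- by split.
- under eq_fun do rewrite EFinM; apply: integrableZl => //.
  apply/integrableP; split => //.
  under eq_integral do rewrite gee0_abs ?lee_fin ?mulr_ge0 ?normc_ge0//.
  by rewrite -ge0_fin_numE// integral_ge0// => m _; rewrite lee_fin mulr_ge0// normc_ge0.
- by move=> m; exact: locop_integral_le.
Qed.

Lemma locop_le k : normc (locop g1 g2 sigma f k) <= A * locop_bound k.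
Proof.
apply: normc_cintegral_bound; first exact: csummable_locop.
apply: (@le_trans _ _
    (\int[mu]_m ((A * l1 g1)%:E * (normc (g2 (k - m)) * s m)%:E))%E).
  apply: ge0_le_integral => //.
    by move=> m _; rewrite lee_fin normc_ge0.
  by move=> m _; rewrite -EFinM lee_fin; exact: locop_integral_le.
rewrite ge0_integralZl//.
- by rewrite /locop_bound mulrA [leRHS]EFinM fineK.
- by move=> m _; rewrite lee_fin mulr_ge0// normc_ge0.
- by rewrite lee_fin mulr_ge0.
Qed.

Lemma locop_defined_bounded : locop_defined g1 g2 sigma f.
Proof.
split; [|exact: cintegrable_locop_integrand|exact: csummable_locop].
move=> m w; apply: (@cintegrable_normc_le _ _ _ _ _ (fun k => f k * (g1 (k - m))^*)).
- by split.
- exact: csummable_bounded_window.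
- by move=> k; rewrite !normcM !normc_conj /modulate normcM normc_cis2pi mul1r.
Qed.

End one_function.

Lemma locop_bound_ge0 k : 0 <= locop_bound k.
Proof.
rewrite mulr_ge0// fine_ge0// integral_ge0// => m _.
by rewrite lee_fin mulr_ge0// normc_ge0.
Qed.

Lemma locop_bound_summable : (\int[mu]_k (locop_bound k)%:E < +oo)%E.
Proof.
have nn0 k m : (0 <= (normc (g2 (k - m)) * s m)%:E)%E.
  by rewrite lee_fin mulr_ge0// normc_ge0.
rewrite /locop_bound; under eq_integral do rewrite EFinM (fineK (integral_g2_s_fin _)).
rewrite ge0_integralZl ?lee_fin//; last first.
  by move=> k _; apply: integral_ge0 => m _; exact: nn0.
apply: lte_mul_pinfty; rewrite ?lee_fin//.
rewrite (fubini_tonelli (fun z : Zn n * Zn n =>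
    (normc (g2 (z.1 - z.2)) * s z.2)%:E)) /=; last 2 first.
- exact: measurable_Zn2.
- by move=> z; exact: nn0.
rewrite (eq_integral (fun m => (l1 g2)%:E * (s m)%:E)%E); last first.
  move=> m _; under eq_integral do rewrite EFinM.
  rewrite ge0_integralZr ?lee_fin//; last by move=> k _; rewrite lee_fin normc_ge0.
  by rewrite integral_normc_shift l1E.
rewrite ge0_integralZl ?lee_fin//; last by move=> m _; rewrite lee_fin.
by apply: lte_mul_pinfty => //; rewrite lee_fin.
Qed.

Lemma locop_linear (a : R[i]) f u (A B : R) :
  (forall k, normc (f k) <= A) -> (forall k, normc (u k) <= B) ->
  locop g1 g2 sigma (a *: f + u) =
  a *: locop g1 g2 sigma f + locop g1 g2 sigma u.
Proof.
move=> fA uB; apply/funext => k.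
have V m w : stftZ g1 (a *: f + u) (m, w) =
    a * stftZ g1 f (m, w) + stftZ g1 u (m, w).
  have sE (v : Zn n -> R[i]) (C : R) : (forall k, normc (v k) <= C) ->
      csummable (fun k => v k * (g1 (k - m))^* * (echar k w)^*).
    move=> vC; apply: (@cintegrable_normc_le _ _ _ _ _
      (fun k => v k * (g1 (k - m))^*)).
    - by split.
    - exact: csummable_bounded_window vC m.
    - by move=> k'; rewrite [leLHS]normcM normc_conj normc_echar mulr1.
  rewrite !stftZE /csum -cintegralZ; last exact: sE fA.
  rewrite -cintegralD; [|exact/cintegrableZ/(sE _ _ fA)|exact: sE uB].
  apply: eq_cintegral => j; have -> : (a *: f + u) j = a * f j + u j by [].
  by rewrite !mulrDl !mulrA.
have I m : cintegral haar (fun w =>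
    sigma (m, w) * stftZ g1 (a *: f + u) (m, w) * modulate w (translate m g2) k) =
  a * cintegral haar (fun w =>
    sigma (m, w) * stftZ g1 f (m, w) * modulate w (translate m g2) k) +
  cintegral haar (fun w =>
    sigma (m, w) * stftZ g1 u (m, w) * modulate w (translate m g2) k).
  have if_ := cintegrable_locop_integrand fA k m.
  have iu_ := cintegrable_locop_integrand uB k m.
  rewrite -cintegralZ// -cintegralD//; last exact: cintegrableZ.
  by apply: eq_cintegral => w; rewrite V; ring.
rewrite [LHS](eq_cintegral _ I) cintegralD; last 2 first.
- exact/cintegrableZ/(csummable_locop fA).
- exact: csummable_locop uB k.
by rewrite cintegralZ//; exact: csummable_locop fA k.
Qed.

End localization_bounds.

(** * Compactness of dominated sets *)

Section lattice_tail.
Variables (R : realType) (n : nat).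
Local Notation mu := (@counting (Zn n) R).
Local Open Scope ereal_scope.

Lemma ge0_integral_countingC (X : set (Zn n)) (f : Zn n -> \bar R) :
  (forall k, 0 <= f k) ->
  \int[mu]_k f k = \int[mu]_(k in X) f k + \int[mu]_(k in ~` X) f k.
Proof.
move=> f0; rewrite -ge0_integral_setU ?setUv//.
by apply/disj_setPS => x [].
Qed.

Lemma summable_tail (h : Zn n -> R) (eps : R) : (forall k, 0 <= h k)%R ->
  \int[mu]_k (h k)%:E < +oo -> (0 < eps)%R ->
  exists2 X : set (Zn n), finite_set X & \int[mu]_(k in ~` X) (h k)%:E <= eps%:E.
Proof.
move=> h0 hoo eps0.
have h0E k : 0 <= (h k)%:E by rewrite lee_fin.
have hfin : \int[mu]_k (h k)%:E \is a fin_num.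
  by rewrite ge0_fin_numE// integral_ge0.
have hfinE := hfin; rewrite integral_countingE// in hfinE.
have [_ [X [finX _] <-]] := ub_ereal_sup_adherent eps0 hfinE.
rewrite -/(esum _ _) -integral_countingE// => hX; exists X => //.
have sumX : \sum_(k \in X) (h k)%:E <= \int[mu]_(k in X) (h k)%:E.
  rewrite integral_mkcond integral_countingE; last first.
    by move=> k; rewrite patchE; case: ifP.
  apply: esum_ge; exists X; first by split.
  by apply: lee_fsum => // k Xk; rewrite patchE mem_set.
have := ge0_integral_countingC X h0E.
have X0 : 0 <= \int[mu]_(k in X) (h k)%:E by exact: integral_ge0.
have Y0 : 0 <= \int[mu]_(k in ~` X) (h k)%:E by exact: integral_ge0.
move: sumX hX X0 Y0; move: hfin.
move: (\int[mu]_k _) (\int[mu]_(k in X) _) (\int[mu]_(k in ~` X) _) => I1 I2 I3.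
move=> Ifin sumX /lt_le_trans/(_ sumX); move: I1 I2 I3 Ifin {sumX hfinE}.
move=> [a| |]// [b| |]// [c| |]//= _; rewrite -?EFinD ?lte_fin ?lee_fin.
by move=> ab b0 c0 [aE]; lra.
Qed.

End lattice_tail.

Section dominated_compact.
Variables (R : realType) (n : nat) (g : Zn n -> R[i]) (p : R).
Hypotheses (g_schwartz : schwartzZ g) (g_neq0 : g <> 0) (p_ge1 : 1 <= p).
Local Notation mu := (@counting (Zn n) R).

Let X := normed_set (MZ g p) (MnormZ g p).

Variable h : Zn n -> R.
Hypothesis h_ge0 : forall k, 0 <= h k.
Hypothesis h_summable : (\int[mu]_k (h k)%:E < +oo)%E.

(** Real and imaginary parts are bounded separately, so that for the pointwise
    topology this is a product of segments. *)
Definition dominated : set X := [set u | forall k,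
  `|complex.Re (\val u k)| <= h k /\ `|complex.Im (\val u k)| <= h k].

(** Evaluation at a point is continuous for the norm of M^p. *)
Lemma dominated_closed : closed dominated.
Proof.
have [C C0 supC] := MnormZ_sup_le g_schwartz g_neq0 p_ge1.
have far (u : X) k (L : R[i] -> R) : (forall z, `|L z| <= normc z) ->
    (forall z1 z2, L (z1 - z2) = L z1 - L z2) -> h k < `|L (\val u k)| ->
    exists2 e : R, 0 < e & forall v : X,
      (MnormZ g p (\val v - \val u)%R < e%:E)%E -> h k < `|L (\val v k)|.
  move=> Lle LB hk; exists ((`|L (\val u k)| - h k) / C) => [|v vu].
    by rewrite divr_gt0// subr_gt0.
  have vuT m : csummable (fun k => (\val v - \val u) k * (g (k - m))^*).
    have [vT _] := set_valP v; have [uT _] := set_valP u.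
    have : csummable (fun k => \val v k * (g (k - m))^* +
        (-1) * (\val u k * (g (k - m))^*)).
      apply: cintegrableD; first exact: temperedZ_csummable.
      exact/cintegrableZ/temperedZ_csummable.
    congr cintegrable; apply/funext => k'.
    by rewrite [(_ - _) k']/(\val v k' - \val u k') mulrBl mulN1r.
  have : ((normc ((\val v - \val u)%R k))%:E < (`|L (\val u k)| - h k)%:E)%E.
    apply: le_lt_trans (supC _ k vuT) _.
    have -> : `|L (\val u k)| - h k = C * ((`|L (\val u k)| - h k) / C).
      by rewrite mulrCA divff ?mulr1// gt_eqF.
    by rewrite EFinM lte_pmul2l// lte_fin.
  rewrite lte_fin [(_ - _) k]/(\val v k - \val u k) => /(le_lt_trans (Lle _)).
  rewrite LB distrC => vuL.
  have := lerB_dist (L (\val u k)) (L (\val v k)); lra.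
rewrite -openC; move=> u /= /existsNP[k /not_andP uk].
have {uk}[hk|hk] : h k < `|complex.Re (\val u k)| \/ h k < `|complex.Im (\val u k)|.
  by case: uk => /negP; rewrite -ltNge; [left|right].
- have [||e e0 H] := far u k _ _ _ hk; [exact: normc_Re_le|by move=> *; rewrite ReD ReN|].
  by exists e => // v /H vk /(_ k)[]; rewrite leNgt vk.
- have [||e e0 H] := far u k _ _ _ hk; [exact: normc_Im_le|by move=> *; rewrite ImD ImN|].
  by exists e => // v /H vk /(_ k)[_]; rewrite leNgt vk.
Qed.

(** Clipping turns all of the product space into dominated functions, so that
   the parametrization below is defined and continuous everywhere. *)
Let clip (a x : R) : R := Num.max (- a) (Num.min a x).

Let clip_bound a x : 0 <= a -> `|clip a x| <= a.
Proof.
move=> a0; rewrite /clip ler_norml ge_max le_max lexx /=.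
by rewrite ge_min lexx /= andbT; lra.
Qed.

Let clip_id a x : `|x| <= a -> clip a x = x.
Proof.
rewrite ler_norml => /andP[ax xa].
by rewrite /clip (min_idPr xa); apply/max_idPr.
Qed.

Let clip_lip a x y : `|clip a x - clip a y| <= `|x - y|.
Proof.
have max_lip (b s t : R) : `|Num.max b s - Num.max b t| <= `|s - t|.
  have [?|?] := leP b s; have [?|?] := leP b t; rewrite ler_norml;
    by have [?|?] := ger0P (s - t); lra.
have min_lip (b s t : R) : `|Num.min b s - Num.min b t| <= `|s - t|.
  have [?|?] := leP b s; have [?|?] := leP b t; rewrite ler_norml;
    by have [?|?] := ger0P (s - t); lra.
exact: le_trans (max_lip _ _ _) (min_lip _ _ _).
Qed.

Let I := (Zn n * bool)%type.
Let prodR := prod_topology (fun _ : I => R : topologicalType).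

Let fclip (v : prodR) : Zn n -> R[i] :=
  fun k => clip (h k) (v (k, true)) +i* clip (h k) (v (k, false)).

Let normc_fclip v k : normc (fclip v k) <= 2 * h k.
Proof.
rewrite (le_trans (normc_le_ReIm _))//= mulr2n mulrDl mul1r lerD//;
  exact: clip_bound.
Qed.

Let fclip_MZ v : MZ g p (fclip v).
Proof.
apply: MZ_csummable => //.
apply: (@cintegrable_le _ _ _ _ _ (fun k => 2 * h k)) => //.
under eq_fun do rewrite EFinM; apply: integrableZl => //.
apply/integrableP; split => //.
by under eq_integral do rewrite gee0_abs ?lee_fin//.
Qed.

Let embed (v : prodR) : X := exist _ (fclip v) (mem_set (fclip_MZ v)).

(** On a dominated set the pointwise topology is finer than the norm topology:
    outside a finite set all the functions are small together. *)
Let embed_continuous : continuous embed.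
Proof.
move=> v U; rewrite nbhsE => -[W [oW Wv] WU].
have [e e0 eW] := oW _ Wv.
have gI0 : (0 <= \int[mu]_k (normc (g k))%:E)%E.
  by apply: integral_ge0 => k _; rewrite lee_fin normc_ge0.
have [Ag gE] : exists Ag : R, (\int[mu]_k (normc (g k))%:E = Ag%:E)%E.
  exists (fine (\int[mu]_k (normc (g k))%:E)%E); rewrite fineK//.
  by rewrite ge0_fin_numE//; exact: schwartzZ_summable.
have Ag0 : 0 <= Ag by rewrite -lee_fin -gE.
pose eta : R := e / (Ag + 1).
have Ag1 : 0 < Ag + 1 by rewrite ltr_wpDl.
have eta0 : 0 < eta by rewrite divr_gt0.
have eta8 : 0 < eta / 8 by rewrite divr_gt0.
(* Two clipped functions differ by at most [4 * h] off [F] and by at most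
   [2 * delta] on [F]; each contribution to the l^1 distance is then at most
   [eta / 2]. *)
have [F finF tailF] := summable_tail h_ge0 h_summable eta8.
have [c FE] : exists c : R, (mu F = c%:E)%E.
  by rewrite /counting/= asboolT//; eexists.
have c0 : 0 <= c by rewrite -lee_fin -FE.
pose delta : R := eta / (4 * (c + 1)).
have c1 : 0 < c + 1 by rewrite ltr_wpDl.
have delta0 : 0 < delta by rewrite divr_gt0// mulr_gt0.
have near_i (i : I) : nbhs v [set v' : prodR | `|v' i - v i| < delta].
  apply: (@proj_continuous I (fun=> R : topologicalType) i v
    [set y : R | `|y - v i| < delta]).
  by apply/nbhs_ballP; exists delta => //= y; rewrite /ball /= distrC.
pose near (k : Zn n) : set prodR :=
  [set v' : prodR | `|v' (k, true) - v (k, true)| < delta] `&`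
  [set v' : prodR | `|v' (k, false) - v (k, false)| < delta].
have near_v k : nbhs v (near k).
  by apply: (@filterI _ _ (nbhs_filter v)); exact: near_i.
have near_F := @filter_bigI _ _ (fset_set F) near _ (nbhs_filter v)
  (fun k _ => near_v k).
apply: (@filterS _ _ (nbhs_filter v) _ _ _ near_F) => v' v'F.
apply/WU/eW => /=.
have {}v'F k : F k -> near k v'.
  by move=> Fk; apply: v'F => /=; rewrite in_fset_set// mem_set.
have dist_l1 : (\int[mu]_k (normc ((fclip v' - fclip v)%R k))%:E <= eta%:E)%E.
  rewrite (ge0_integral_countingC F) => [|k]; last by rewrite lee_fin normc_ge0.
  have -> : eta = 2 * delta * (c + 1) + 4 * (eta / 8).
    by rewrite /delta; field; rewrite gt_eqF.
  rewrite EFinD; apply: leeD.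
  - apply: (@le_trans _ _ (\int[mu]_(k in F) (cst (2 * delta)%:E k))%E).
      apply: ge0_le_integral => //; first by move=> k _; rewrite lee_fin normc_ge0.
      move=> k Fk; have [re im] := v'F k Fk.
      rewrite lee_fin (le_trans (normc_le_ReIm _))// mulr2n mulrDl mul1r.
      by apply: lerD; rewrite (le_trans (clip_lip _ _ _))// ltW.
    rewrite integral_cst// [X in (_ * X)%E](_ : _ = c%:E)//.
    by rewrite -EFinM lee_fin ler_wpM2l ?lerDl// mulr_ge0// ltW.
  - apply: (@le_trans _ _ (\int[mu]_(k in ~` F) (4%:E * (h k)%:E))%E).
      apply: ge0_le_integral => //; first by move=> k _; rewrite lee_fin normc_ge0.
      move=> k _; rewrite -EFinM lee_fin.
      apply: (le_trans (le_normcD (fclip v' k) (- fclip v k))).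
      rewrite normcN (_ : 4 * h k = 2 * h k + 2 * h k); last by ring.
      by rewrite lerD.
    rewrite ge0_integralZl//; last by move=> k _; rewrite lee_fin.
    by rewrite EFinM; apply: lee_wpmul2l => //; rewrite lee_fin.
have gAg : (\int[mu]_k (normc (g k))%:E <= Ag%:E)%E by rewrite gE.
apply: (le_lt_trans (MnormZ_le_l1 p_ge1 dist_l1 gAg)).
by rewrite lte_fin /eta mulrAC ltr_pdivrMr// ltr_pM2l// ltrDl.
Qed.

Lemma dominated_compact : compact dominated.
Proof.
have cube : @compact prodR [set v | forall i, `[- h i.1, h i.1]%classic (v i)].
  apply: (@tychonoff I (fun=> R : topologicalType)
    (fun i => `[- h i.1, h i.1]%classic)) => i.
  exact: segment_compact.
have := continuous_compact (continuous_subspaceT embed_continuous) cube.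
congr compact; apply/seteqP; split => [_ [v _ <-] k /=|u du].
  by split; exact: clip_bound.
pose v : prodR := fun i => if i.2 then complex.Re (\val u i.1) else complex.Im (\val u i.1).
exists v.
  by move=> [k b] /=; rewrite in_itv /= -ler_norml /v /=; have [? ?] := du k; case: b.
apply/val_inj/funext => k /=; rewrite /fclip /v /=.
have [re im] := du k; rewrite !clip_id//.
by case: (\val u k).
Qed.

End dominated_compact.

(** * Compactness of the localization operator *)

Theorem proposition4p14 (R : realType) (n : nat)
  (g : Zn n -> R[i]) (g_schwartz : schwartzZ g) (g_neq0 : g <> 0)
  (G : Zn n * 'rV[R]_n -> R[i]) (G_schwartz : schwartzZT G) (G_neq0 : G <> 0)
  (sigma : Zn n * 'rV[R]_n -> R[i]) (sigma_M1 : MZT G 1 sigma)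
  (g1 g2 : Zn n -> R[i]) (g1_M1 : MZ g 1 g1) (g2_M1 : MZ g 1 g2)
  (p : R) (p_ge2 : 2 <= p) :
  (forall f, MZ g p f -> locop_defined g1 g2 sigma f) /\
  compact_operator (MZ g p) (MnormZ g p) (locop g1 g2 sigma).
Proof.
have p_ge1 : 1 <= p by lra.
have [sigmaT sigmaL] := sigma_M1.
have slice := cintegrable_symbol_slice sigmaT.
have [s [s0 ssum scoef]] := symbol_coef_dominated sigmaT G_schwartz G_neq0 sigmaL.
have sg1 := MZ1_summable g_schwartz g_neq0 g1_M1.
have sg2 := MZ1_summable g_schwartz g_neq0 g2_M1.
have [C C0 supC] := MnormZ_sup_le g_schwartz g_neq0 p_ge1.
have bounded f (r : R) : MZ g p f -> (MnormZ g p f <= r%:E)%E ->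
    forall k, normc (f k) <= C * r.
  move=> [fT _] fr k; rewrite -lee_fin.
  have fg m := temperedZ_csummable m g_schwartz fT.
  rewrite (le_trans (supC f k fg))// EFinM.
  by apply: lee_wpmul2l => //; rewrite lee_fin ltW.
have bounded_ex f : MZ g p f -> exists A, forall k, normc (f k) <= A.
  move=> fM; exists (C * fine (MnormZ g p f)); apply: bounded => //.
  have [_ [_ foo]] := fM; rewrite fineK// ge0_fin_numE//; exact: Lnorm_ge0.
pose h := locop_bound s g1 g2.
have h0 k : 0 <= h k by exact: locop_bound_ge0.
have hsum : (\int[counting]_k (h k)%:E < +oo)%E by exact: locop_bound_summable.
have csummable_h (A : R) : 0 <= A -> (\int[counting]_k (A * h k)%:E < +oo)%E.
  move=> A0; under eq_integral do rewrite EFinM.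
  rewrite ge0_integralZl ?lee_fin//; last by move=> k _; rewrite lee_fin.
  by apply: lte_mul_pinfty; rewrite ?lee_fin.
have locopM f : MZ g p f -> MZ g p (locop g1 g2 sigma f).
  move=> /bounded_ex[A fA].
  have A0 : 0 <= A by rewrite (le_trans _ (fA 0))// normc_ge0.
  apply: MZ_csummable => //; apply/csummableP.
  apply: le_lt_trans (csummable_h A A0); apply: ge0_le_integral => //.
    by move=> k _; rewrite lee_fin normc_ge0.
  by move=> k _; rewrite lee_fin; exact: locop_le.
split.
  by move=> f /bounded_ex[A fA]; exact: locop_defined_bounded fA.
split => //.
- move=> a f u /bounded_ex[A fA] /bounded_ex[B uB].
  exact: locop_linear fA uB.
move=> S SM [r Sr]; pose A := C * `|r|.
have A0 : 0 <= A by rewrite mulr_ge0// ltW.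
have Ah0 k : 0 <= A * h k by rewrite mulr_ge0.
have cK := dominated_compact g_schwartz p_ge1 Ah0 (csummable_h A A0).
have clK := @dominated_closed _ _ _ _ g_schwartz g_neq0 p_ge1 (fun k => A * h k).
apply: (@precompact_subset _ _ (@dominated _ _ g p (fun k => A * h k))).
  move=> u [f Sf uE] k.
  have fA : forall k, normc (f k) <= A.
    apply: bounded; first exact: SM.
    by rewrite (le_trans (Sr f Sf))// lee_fin ler_norm.
  have uk : normc (\val u k) <= A * h k by rewrite uE; exact: locop_le.
  by split; [rewrite (le_trans (normc_Re_le _))|rewrite (le_trans (normc_Im_le _))].
by rewrite precompact_closed.
Qed.
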